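(* Let $k$ be a field, $n\ge1$, $R=k[x_1,\ldots,x_n]$, $b>0$ and $a>2b$ integers, and let $I=(x_1^a,\ldots,x_n^a,(x_1\cdots x_n)^b)\subset R$. With $S=R[y_1,\ldots,y_n,w]$ and the ideals $\mathcal H(i_1,\ldots,i_j)\subset S$ as specified in the context, $S/\mathcal H(i_1,\ldots,i_j)$ has depth at least $n$ for every tuple $i_1<\cdots<i_j$ (indexing one of the Sylvester forms of the context). In particular, the Rees algebra $\mathcal R_R(I)=R[It]$ of $I$ is an almost Cohen--Macaulay ring.
   Context: If $a\le nb$, $p$ is the unique integer with $1\le p\le n$ and $(p-1)b<a\le pb$; if $a>nb$, $p=n$. (So $p-1$ is the reduction number of $I$.) For $\{i_1,\ldots,i_j\}\subset\{1,\ldots,n\}$, $P(i_1,\ldots,i_j)$ is the product of the variables in $\{x_1,\ldots,x_n\}\setminus\{x_{i_1},\ldots,x_{i_j}\}$. Let $K_{i,l}=x_i^ay_l-x_l^ay_i$ ($1\le i<l\le n$), $L_i=x_i^{a-b}w-P(i)^by_i$ ($1\le i\le n$), and let $\mathcal L\subset S$ be the ideal generated by all $K_{i,l}$ and $L_i$. Sylvester forms: for $2\le j\le p-1$ and $1\le i_1<\cdots<i_j\le n$, $$H_j^{i_1,\ldots,i_j}=(x_{i_1}\cdots x_{i_j})^{a-jb}w^j-P(i_1,\ldots,i_j)^{jb}y_{i_1}\cdots y_{i_j};$$ in degree $p$ there is the single form $H_p^{1,\ldots,p}$, equal to $w^p-P(1,\ldots,p)^{pb}(x_1\cdots x_p)^{pb-a}y_1\cdots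 y_p$ if $a\le nb$, and to $(x_1\cdots x_n)^{a-nb}w^n-y_1\cdots y_n$ if $a>nb$ (where $p=n$). Ordering of the forms: forms of smaller degree $j$ come first; among forms of the same degree $j$, $H_j^{i_1,\ldots,i_j}$ comes before $H_j^{k_1,\ldots,k_j}$ if $i_t<k_t$ for the first index $t$ with $i_t\ne k_t$. The ideal $\mathcal H(i_1,\ldots,i_j)=(\mathcal L,H_2^{1,2},\ldots,H_j^{i_1,\ldots,i_j})\subset S$ is generated by $\mathcal L$ together with all Sylvester forms up to and including $H_j^{i_1,\ldots,i_j}$ in this ordering; the tuples considered are those indexing these forms (including $(1,\ldots,p)$). Depth is computed with respect to the maximal ideal $(x_1,\ldots,x_n,y_1,\ldots,y_n,w)$ of $S$, where $R[It]$ is viewed as an $S$-module via $y_j\mapsto x_j^at$, $w\mapsto (x_1\cdots x_n)^bt$. The Rees algebra has dimension $n+1$; it is called almost Cohen--Macaulay if its depth is at least $n$. *)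

(* Defs.v *)
From HB Require Import structures.
From mathcomp Require Import all_boot all_order all_algebra.
From mathcomp Require Import boolp.
From mathcomp Require Import generic_quotient ring_quotient mpoly.

Set Implicit Arguments.
Unset Strict Implicit.
Unset Printing Implicit Defensive.

Import GRing.Theory.
Local Open Scope ring_scope.
Local Open Scope quotient_scope.

Section GeneratedIdeal.
Variable S : comNzRingType.

(* The generators are given by a Prop-valued predicate, so membership in the
   generated ideal is made boolean classically. *)
Definition gen_ideal (G : S -> Prop) : {pred S} := fun x =>
  `[< exists (m : nat) (c g : 'I_m -> S),
        (forall i, G (g i)) /\ x = \sum_i c i * g i >].

Lemma gen_idealP (G : S -> Prop) (x : S) :
  reflect (exists (m : nat) (c g : 'I_m -> S),
             (forall i, G (g i)) /\ x = \sum_i c i * g i)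
          (x \in gen_ideal G).
Proof. exact: asboolP. Qed.

Lemma gen_ideal_gen (G : S -> Prop) (x : S) : G x -> x \in gen_ideal G.
Proof.
move=> Gx; apply/gen_idealP; exists 1%N, (fun=> 1), (fun=> x).
by rewrite big_ord1 mul1r.
Qed.

Lemma gen_ideal0 (G : S -> Prop) : 0 \in gen_ideal G.
Proof.
by apply/gen_idealP; exists 0%N, (fun=> 0), (fun=> 0); rewrite big_ord0; split=> // -[].
Qed.

Lemma gen_idealD (G : S -> Prop) : {in gen_ideal G &, forall x y, x + y \in gen_ideal G}.
Proof.
move=> x y /gen_idealP[m [c [g [Gg ->]]]] /gen_idealP[m' [c' [g' [Gg' ->]]]].
apply/gen_idealP; exists (m + m')%N.
exists (fun i => match split i with inl j => c j | inr j => c' j end).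
exists (fun i => match split i with inl j => g j | inr j => g' j end).
split=> [i|]; first by case: (split i).
rewrite big_split_ord /=; congr (_ + _); apply: eq_bigr => i _.
  by rewrite (unsplitK (inl i)).
by rewrite (unsplitK (inr i)).
Qed.

Lemma gen_idealMl (G : S -> Prop) (u x : S) :
  x \in gen_ideal G -> u * x \in gen_ideal G.
Proof.
move=> /gen_idealP[m [c [g [Gg ->]]]]; apply/gen_idealP.
exists m, (fun i => u * c i), g; split=> //.
by rewrite mulr_sumr; apply: eq_bigr => i _; rewrite mulrA.
Qed.

Lemma gen_ideal_zmod_closed (G : S -> Prop) : zmod_closed (gen_ideal G).
Proof.
split=> [|x y xI yI]; first exact: gen_ideal0.
by apply: gen_idealD => //; rewrite -mulN1r; apply: gen_idealMl.
Qed.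

HB.instance Definition _ (G : S -> Prop) :=
  GRing.isZmodClosed.Build S (gen_ideal G) (gen_ideal_zmod_closed G).

(* S/(G) as an S-module; no properness of (G) is required. *)
Definition quot_mod (G : S -> Prop) := {ideal_quot gen_ideal G}.
HB.instance Definition _ (G : S -> Prop) := GRing.Zmodule.on (quot_mod G).

Section QuotMod.
Variable G : S -> Prop.
Implicit Types (f : S) (u v : quot_mod G).

Definition quot_pi (f : S) : quot_mod G := \pi_{ideal_quot gen_ideal G} f.
Definition quot_scale f u : quot_mod G :=
  quot_pi (f * repr (u : {ideal_quot gen_ideal G})).

Lemma quot_pi_eq (f g : S) : (quot_pi f = quot_pi g) <-> (f - g \in gen_ideal G).
Proof. by split=> [/eqP|fg]; [|apply/eqP]; rewrite -Quotient.idealrBE. Qed.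

Lemma quot_pi_surj u : exists f, u = quot_pi f.
Proof. by exists (repr (u : {ideal_quot gen_ideal G})); rewrite /quot_pi reprK. Qed.

Lemma quot_piD f g : quot_pi (f + g) = quot_pi f + quot_pi g.
Proof. by rewrite /quot_pi raddfD. Qed.

Lemma quot_scale_pi f g : quot_scale f (quot_pi g) = quot_pi (f * g).
Proof.
apply/quot_pi_eq; rewrite -mulrBr; apply: gen_idealMl.
by apply/quot_pi_eq; rewrite /quot_pi reprK.
Qed.

Fact quot_scaleA f g u : quot_scale f (quot_scale g u) = quot_scale (f * g) u.
Proof. by have [h ->] := quot_pi_surj u; rewrite !quot_scale_pi mulrA. Qed.
Fact quot_scale1 : left_id 1 quot_scale.
Proof. by move=> u; have [h ->] := quot_pi_surj u; rewrite quot_scale_pi mul1r. Qed.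
Fact quot_scaleDr : right_distributive quot_scale +%R.
Proof.
move=> f u v; have [g ->] := quot_pi_surj u; have [h ->] := quot_pi_surj v.
by rewrite -quot_piD !quot_scale_pi -quot_piD mulrDr.
Qed.
Fact quot_scaleDl u : {morph quot_scale^~ u : f g / f + g}.
Proof.
move=> f g /=; have [h ->] := quot_pi_surj u.
by rewrite !quot_scale_pi -quot_piD mulrDl.
Qed.

HB.instance Definition _ := GRing.Zmodule_isLmodule.Build S (quot_mod G)
  quot_scaleA quot_scale1 quot_scaleDr quot_scaleDl.
End QuotMod.

End GeneratedIdeal.

Section Depth.
Variables (S : comNzRingType) (M : lmodType S).

(* v belongs to the submodule (s_0, s_1, ...) M *)
Definition in_seq_smul (s : seq S) (v : M) : Prop :=
  exists m : 'I_(size s) -> M, v = \sum_(i < size s) s`_i *: m i.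

Definition regular_seq (s : seq S) : Prop :=
  (forall i, (i < size s)%N -> forall v : M,
     in_seq_smul (take i s) (s`_i *: v) -> in_seq_smul (take i s) v) /\
  (exists v : M, ~ in_seq_smul s v).

(* The depth of M with respect to m is the supremum of the lengths of the
   M-regular sequences with entries in m. *)
Definition depth_ge (m : {pred S}) (d : nat) : Prop :=
  exists s : seq S, [/\ (d <= size s)%N, {subset s <= m} & regular_seq s].
End Depth.

Section ReesAlgebra.
Variable R : comNzRingType.

Definition ideal_pow (I : {pred R}) (j : nat) : {pred R} :=
  gen_ideal (fun x => exists f : 'I_j -> R,
    (forall i, f i \in I) /\ x = \prod_i f i).

Lemma ideal_powM (I : {pred R}) (i j : nat) (x y : R) :
  x \in ideal_pow I i -> y \in ideal_pow I j -> x * y \in ideal_pow I (i + j).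
Proof.
move=> /gen_idealP[m [c [g [Gg ->]]]] /gen_idealP[m' [c' [g' [Gg' ->]]]].
rewrite mulr_suml; apply: rpred_sum => s _; rewrite mulr_sumr.
apply: rpred_sum => t _; rewrite mulrACA; apply: gen_idealMl.
have [f [fI ->]] := Gg s; have [f' [fI' ->]] := Gg' t.
apply: gen_ideal_gen.
exists (fun l => match split l with inl l => f l | inr l => f' l end).
split=> [l|]; first by case: (split l).
rewrite big_split_ord /=; congr (_ * _); apply: eq_bigr => l _.
  by rewrite (unsplitK (inl l)).
by rewrite (unsplitK (inr l)).
Qed.

Lemma ideal_pow0 (I : {pred R}) (x : R) : x \in ideal_pow I 0.
Proof.
rewrite -[x]mulr1; apply: gen_idealMl; apply: gen_ideal_gen.
by exists (fun=> 0); rewrite big_ord0; split=> // -[].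
Qed.

Lemma ideal_pow1 (I : {pred R}) (x : R) : x \in I -> x \in ideal_pow I 1.
Proof.
by move=> xI; apply: gen_ideal_gen; exists (fun=> x); rewrite big_ord1.
Qed.

(* R[It], the sum of the I^j t^j inside R[t] = {poly R} *)
Definition rees_pred (I : {pred R}) : {pred {poly R}} := fun f =>
  `[< forall j : nat, f`_j \in ideal_pow I j >].

Lemma rees_predP (I : {pred R}) (f : {poly R}) :
  reflect (forall j : nat, f`_j \in ideal_pow I j) (f \in rees_pred I).
Proof. exact: asboolP. Qed.

Lemma rees_subring_closed (I : {pred R}) : subring_closed (rees_pred I).
Proof.
split=> [|f g /rees_predP fI /rees_predP gI|f g /rees_predP fI /rees_predP gI];
  apply/rees_predP => j.
- by rewrite coef1; case: j => [|j]; [exact: ideal_pow0 | exact: rpred0].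
- by rewrite coefB; apply: rpredB.
- rewrite coefM; apply: rpred_sum => i _.
  by have := ideal_powM (fI i) (gI (j - i)%N); rewrite subnKC // -ltnS.
Qed.

HB.instance Definition _ (I : {pred R}) :=
  GRing.isSubringClosed.Build {poly R} (rees_pred I) (rees_subring_closed I).

Lemma rees_polyC (I : {pred R}) (c : R) : c%:P \in rees_pred I.
Proof.
apply/rees_predP => j; rewrite coefC.
by case: j => [|j]; [exact: ideal_pow0 | exact: rpred0].
Qed.

Lemma rees_linear (I : {pred R}) (c : R) : c \in I -> c *: 'X \in rees_pred I.
Proof.
move=> cI; apply/rees_predP => j; rewrite coefZ coefX.
case: j => [|[|j]]; rewrite ?mulr0 ?mulr1 ?rpred0 //; exact: ideal_pow1.
Qed.

Record rees_alg (I : {pred R}) := ReesAlg {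
  rees_val :> {poly R};
  _ : rees_val \in rees_pred I
}.
HB.instance Definition _ (I : {pred R}) := [isSub for @rees_val I].
HB.instance Definition _ (I : {pred R}) := [Choice of rees_alg I by <:].
HB.instance Definition _ (I : {pred R}) :=
  [SubChoice_isSubComNzRing of rees_alg I by <:].
End ReesAlgebra.

Section Forms.
Variables (k : fieldType) (n a b : nat).

Notation R := {mpoly k[n]}.

(* S = R[y_1, ..., y_n, w] is k[x_1, ..., x_n, y_1, ..., y_n, w]; all indices
   start from 0. *)
Definition polS : comNzRingType := {mpoly k[n + n + 1]}.

Definition xS (i : 'I_n) : polS := 'X_(lshift 1 (lshift n i)).
Definition yS (i : 'I_n) : polS := 'X_(lshift 1 (rshift n i)).
Definition wS : polS := 'X_(rshift (n + n) ord0).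

Definition maxS : {pred polS} :=
  gen_ideal (fun f : polS => exists i : 'I_(n + n + 1), f = 'X_i).

(* P(i_1, ..., i_j) *)
Definition coprod (s : seq 'I_n) : polS := \prod_(l < n | l \notin s) xS l.

Definition formK (i l : 'I_n) : polS := xS i ^+ a * yS l - xS l ^+ a * yS i.
Definition formL (i : 'I_n) : polS :=
  xS i ^+ (a - b) * wS - coprod [:: i] ^+ b * yS i.

Definition idealL : {pred polS} := gen_ideal (fun f : polS =>
  (exists i l : 'I_n, (i < l)%N /\ f = formK i l) \/ (exists i, f = formL i)).

Definition is_p (p : nat) : Prop :=
  if (a <= n * b)%N then (1 <= p <= n)%N /\ ((p - 1) * b < a <= p * b)%N
  else p = n.

(* The tuples i_1 < ... < i_j with 2 <= j <= p - 1, and (1, ..., p). *)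
Definition form_index (p : nat) (s : seq 'I_n) : Prop :=
  (sorted ltn (map val s) /\ (2 <= size s <= p - 1)%N) \/ map val s = iota 0 p.

(* The truncated subtractions are all genuine ones when is_p p holds and s is
   an index in the sense of form_index. *)
Definition sylvester (p : nat) (s : seq 'I_n) : polS :=
  let j := size s in
  let xs := \prod_(i <- s) xS i in
  let ys := \prod_(i <- s) yS i in
  if (j < p)%N then xs ^+ (a - j * b) * wS ^+ j - coprod s ^+ (j * b) * ys
  else if (a <= n * b)%N then
    wS ^+ p - coprod s ^+ (p * b) * xs ^+ (p * b - a) * ys
  else xs ^+ (a - n * b) * wS ^+ n - ys.

Definition form_before (s u : seq 'I_n) : Prop :=
  (size s < size u)%N \/
  (size s = size u /\
   exists t : nat, [/\ (t < size s)%N, take t s = take t u &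
     (nth 0 (map val s) t < nth 0 (map val u) t)%N]).

Definition H_gens (p : nat) (s : seq 'I_n) (f : polS) : Prop :=
  f \in idealL \/
  exists u, [/\ form_index p u, u = s \/ form_before u s & f = sylvester p u].

Definition idealI : {pred R} := gen_ideal (fun f : R =>
  (exists i : 'I_n, f = 'X_i ^+ a) \/ f = (\prod_(i < n) 'X_i) ^+ b).

(* x_i |-> x_i, y_i |-> x_i^a t, w |-> (x_1 ... x_n)^b t *)
Definition rees_var (i : 'I_(n + n + 1)) : {poly R} :=
  match split i with
  | inl i' => match split i' with
              | inl j => ('X_j : R)%:P
              | inr j => ('X_j ^+ a : R) *: 'X
              end
  | inr _ => ((\prod_(j < n) 'X_j) ^+ b : R) *: 'X
  end.

Definition rees_map : polS -> {poly R} :=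
  mmap (polyC \o @mpolyC n k) rees_var.
HB.instance Definition _ := GRing.RMorphism.on rees_map.

Lemma rees_map_in (f : polS) : rees_map f \in rees_pred idealI.
Proof.
apply: rpred_sum => m _; apply: rpredM; first exact: rees_polyC.
apply: rpred_prod => i _; apply: rpredX; rewrite /rees_var.
case: split => [i'|_]; last by apply/rees_linear/gen_ideal_gen; right.
case: split => j; first exact: rees_polyC.
by apply/rees_linear/gen_ideal_gen; left; exists j.
Qed.

(* R[It], viewed as an S-module via rees_map *)
Definition rees_mod := rees_alg idealI.
HB.instance Definition _ := GRing.ComNzRing.on rees_mod.

Definition rees_scale (f : polS) (u : rees_mod) : rees_mod :=
  ReesAlg (rpredM (rees_map_in f) (valP u)).

Fact rees_scaleA f g u : rees_scale f (rees_scale g u) = rees_scale (f * g) u.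
Proof. by apply: val_inj; rewrite /= rmorphM mulrA. Qed.
Fact rees_scale1 : left_id 1 rees_scale.
Proof. by move=> u; apply: val_inj; rewrite /= rmorph1 mul1r. Qed.
Fact rees_scaleDr : right_distributive rees_scale +%R.
Proof. by move=> f u v; apply: val_inj; rewrite /= mulrDr. Qed.
Fact rees_scaleDl u : {morph rees_scale^~ u : f g / f + g}.
Proof. by move=> f g; apply: val_inj; rewrite /= rmorphD mulrDl. Qed.

HB.instance Definition _ := GRing.Zmodule_isLmodule.Build polS rees_mod
  rees_scaleA rees_scale1 rees_scaleDr rees_scaleDl.

(* R[It] has dimension n + 1, so almost Cohen-Macaulay means depth >= n. *)
Definition rees_almost_CM : Prop := depth_ge rees_mod maxS n.
End Forms.

Arguments maxS k n _ : clear implicits.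
Arguments H_gens k n a b p s f : clear implicits.
Arguments rees_almost_CM k n a b : clear implicits.

(* Main.v *)
Require Import Defs.
From mathcomp Require Import all_boot all_algebra.
From mathcomp Require Import boolp mpoly zify.

(* Put theta_i = y_i - x_(i+1)^a for i < n and theta_n = y_n. Both S/H and R[It] are
   free modules M over k[theta_1, ..., theta_n], so theta_1, ..., theta_n is an
   M-regular sequence.

   L_i and all Sylvester forms have the shape
     F_U = x_U^(a-ub) w^u - P(U)^(ub) x_U^(ub-a) y_U,  u = |U|,
   with truncated exponents, and both terms have the same image in R[It]. So a
   rewriting step with F_U, taken modulo the K_(i,l), preserves the image
   x^A t^D of a monomial and only replaces its w-degree j by j - u. These steps
   are confluent: if F_U and F_U' apply to the same monomial and |U| < |U'|, then
   F_V applies after F_U for every V in U' minus U with |V| = |U'| - |U|, and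
   leads to the w-degree given by F_U'. This gives a monomial basis of M. Its
   elements of w-degree j > 0 form a k-basis of a free k[y]-module on which y_i is
   the leading term of theta_i for the w-degree; those of w-degree 0 form a basis
   of the Rees algebra of (x_1^a, ..., x_n^a), where either y_i or x_(i+1)^a is the
   leading term of theta_i for a suitable weight. In both cases the leading terms
   of the theta_i act freely on the basis, hence so do the theta_i on M.

   In R[It] a normal monomial is determined by its image x^A t^D when all the sets
   U with (|U| - 1) b < a are allowed, so R[It] is treated in the same way. *)

Set Implicit Arguments.
Unset Strict Implicit.
Unset Printing Implicit Defensive.

Import GRing.Theory.

Local Open Scope nat_scope.

(** * Combinatorics of the rewriting steps *)

Section PartialSums.
Variables (n a : nat).
Implicit Types (A : 'X_{1..n}) (i l D r : nat).

(* [quo A i] is [A i %/ a], and 0 if [n <= i]; [shift i] is [a] times the [i]-th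
   unit vector, and 0 if [n <= i]. *)
Definition quo A i : nat := \sum_(l < n | l == i :> nat) A l %/ a.
Definition psum A i : nat := \sum_(l < n | l <= i) A l %/ a.
Definition quo_sum A : nat := \sum_(l < n) A l %/ a.
Definition shift i : 'X_{1..n} := [multinom a * (l == i :> nat) | l < n].

Lemma quo_ord A (i : 'I_n) : quo A i = A i %/ a.
Proof. by rewrite /quo (big_pred1 i) => // l; rewrite -val_eqE. Qed.

Lemma psumS A i : psum A i.+1 = psum A i + quo A i.+1.
Proof.
rewrite /psum /quo (bigID (fun l : 'I_n => l <= i)) /=; congr (_ + _);
  apply: eq_bigl => l; lia.
Qed.

Lemma quo_le_psum A i : quo A i <= psum A i.
Proof.
case: i => [|i]; rewrite ?psumS ?leq_addl // /quo /psum.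
by apply/eq_leq/eq_bigl => l; lia.
Qed.

Lemma psum_mono A i l : i <= l -> psum A i <= psum A l.
Proof.
move=> /subnK <-; elim: (l - i) => // d IH.
by rewrite addSn psumS (leq_trans IH) // leq_addr.
Qed.

Lemma psum_quo A i l : i < l -> psum A i + quo A l <= psum A l.
Proof. by case: l => // l il; rewrite psumS leq_add2r psum_mono. Qed.

Lemma psum_leq A i : psum A i <= quo_sum A.
Proof. by rewrite /psum /quo_sum [leqRHS](bigID (fun l : 'I_n => l <= i)) leq_addr. Qed.

Lemma psum_max A i : n <= i.+1 -> psum A i = quo_sum A.
Proof. by move=> ni; apply: eq_bigl => l; have := ltn_ord l; lia. Qed.

Hypothesis a_gt0 : 0 < a.

Lemma divn_shift A i (l : 'I_n) : (A + shift i)%MM l %/ a = A l %/ a + (l == i :> nat).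
Proof.
rewrite mnmDE mnmE addnC; case: eqP => _; rewrite ?muln0 ?muln1 ?addn0 //.
by rewrite divnDl // divnn a_gt0 addnC.
Qed.

Lemma sum_ord_eq (P : pred 'I_n) i : i < n ->
  \sum_(l < n | P l) (l == i :> nat) = if insub i is Some i' then P i' : nat else 0.
Proof.
move=> ltin; rewrite insubT big_mkcond (bigD1 (Ordinal ltin)) //= eqxx big1 => [|l].
  by rewrite addn0; case: (P _).
by rewrite -val_eqE /= => /negbTE ->; case: (P l).
Qed.

Lemma quo_shift A i l : i < n -> quo (A + shift i) l = quo A l + (l == i).
Proof.
move=> ltin; rewrite /quo; under eq_bigr do rewrite divn_shift.
by rewrite big_split /= sum_ord_eq // insubT /= eq_sym.
Qed.

Lemma psum_shift A i l : i < n -> psum (A + shift i) l = psum A l + (i <= l).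
Proof.
move=> ltin; rewrite /psum; under eq_bigr do rewrite divn_shift.
by rewrite big_split /= sum_ord_eq // insubT.
Qed.

Lemma quo_sum_shift A i : i < n -> quo_sum (A + shift i) = (quo_sum A).+1.
Proof.
move=> ltin; rewrite /quo_sum; under eq_bigr do rewrite divn_shift.
by rewrite big_split /= sum_ord_eq // insubT addn1.
Qed.

Lemma subshift A i : 0 < quo A i -> exists2 A', A = (A' + shift i)%MM & i < n.
Proof.
have [ltin|lein] := ltnP i n; last first.
  by rewrite /quo big1 // => l /eqP li; have := ltn_ord l; lia.
rewrite -[i]/(val (Ordinal ltin)) quo_ord => q0.
exists (A - shift i)%MM => //; apply/mnmP => l; rewrite mnmDE mnmBE mnmE.
case: eqP => [li|_]; last by rewrite muln0 subn0 addn0.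
rewrite muln1 subnK // -(divn_gt0 _ a_gt0).
by rewrite (_ : l = Ordinal ltin) //; apply: val_inj.
Qed.

(* The monomials x^A t^D with [D <= quo_sum A] form a basis of the Rees algebra of
   (x_1^a, ..., x_n^a). The leading term of theta_i times such a monomial is its
   product with y_i if [use_y], with x_(i+1)^a otherwise; [exponent] is the number
   of times that this product can be undone. *)

Definition use_y A D i : bool := quo_sum A - D <= psum A i.

Definition exponent A D i : nat :=
  let r := quo_sum A - D in
  if r <= psum A i then minn (quo A i) (psum A i - r)
  else minn (quo A i.+1) (r - psum A i).-1.

Lemma use_y_next A D i : D <= quo_sum A -> i < n -> ~~ use_y A D i -> i.+1 < n.
Proof.
move=> DA ltin; rewrite ltnNge; apply: contraNN => ni.
by rewrite /use_y psum_max // leq_subr.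
Qed.

Lemma use_y_shiftY A D i l : D <= quo_sum A -> i < n -> use_y A D i ->
  use_y (A + shift i) D.+1 l = use_y A D l.
Proof.
move=> DA ltin; rewrite /use_y quo_sum_shift // psum_shift // subSS.
by have [/(psum_mono A)|] := leqP i l; lia.
Qed.

Lemma use_y_shiftX A D i l : D <= quo_sum A -> i < n -> ~~ use_y A D i ->
  use_y (A + shift i.+1) D l = use_y A D l.
Proof.
move=> DA ltin nY; have ltSin := use_y_next DA ltin nY.
move: nY; rewrite /use_y quo_sum_shift // psum_shift //.
by have [_|/(psum_mono A)] := ltnP i l; lia.
Qed.

(** Line up the blocks x_l^a of A in the order of l, the first r = quo_sum A - D staying powers of x
    and the others becoming y's. Then [exponent] counts the y_i, or else the x_(i+1)^a before the
    r-th block. The new block falls after the r-th one. Where it enters the minimum for some l other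
    than i, that minimum is attained by the unchanged argument. *)
Lemma exponent_shiftY A D i l : D <= quo_sum A -> i < n -> use_y A D i ->
  exponent (A + shift i) D.+1 l = exponent A D l + (l == i).
Proof.
move=> DA ltin; rewrite /use_y /exponent quo_sum_shift // psum_shift // !quo_shift // subSS.
have := quo_le_psum A l; have := psumS A l.
case: (ltngtP i l) => [il|li|->] /= le1 le2 ri.
- by have := psum_quo A il; do 2 case: ifP; lia.
- have [e|ne] := eqVneq l.+1 i; first by subst i; have := psum_mono A li; do 2 case: ifP; lia.
  by have := psum_mono A li; do 2 case: ifP; lia.
- by do 2 case: ifP; lia.
Qed.

(** Symmetric case: the new block x_(i+1)^a is placed before the r-th one, which becomes the
    (r+1)-th. *)
Lemma exponent_shiftX A D i l : D <= quo_sum A -> i < n -> ~~ use_y A D i ->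
  exponent (A + shift i.+1) D l = exponent A D l + (l == i).
Proof.
move=> DA ltin nY; have ltSin := use_y_next DA ltin nY; move: nY.
rewrite /use_y /exponent quo_sum_shift // psum_shift // !quo_shift //.
have := quo_le_psum A l; have := psumS A l; have := psumS A i; have := quo_le_psum A i.
case: (ltngtP i l) => [il|li|->] /= e1 e2 le1 le2 ri.
- have [e|ne] := eqVneq i.+1 l; first by subst l; do 2 case: ifP; lia.
  by have := @psum_quo A i.+1 l; have := psum_mono A il; do 2 case: ifP; lia.
- have [e|ne] := eqVneq l.+1 i; first by subst i; have := psum_mono A li; do 2 case: ifP; lia.
  by have := psum_mono A li; do 2 case: ifP; lia.
- by do 2 case: ifP; lia.
Qed.

(* With r = quo_sum A - D and s_l = psum A l, the convex function
   (r - s_l) + (r - 1 - s_l) (truncated) changes by at most 2 in a multiplication by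
   x_(i+1)^a, and strictly less for l = i if [use_y]; the linear term is chosen so
   that both choices of the leading term add [weight_theta i]. *)
Definition weight A D : nat :=
  let r := quo_sum A - D in
  \sum_(l < n) (2 * l.+1 * psum A l + (r - psum A l) + (r.-1 - psum A l)).

Definition weight_theta i : nat := \sum_(l < n | i <= l) 2 * l.+1.

(** The term 2(i+1) of index i is distributed as 2 over each l <= i. In this form it is the termwise
    increment of [weight] when x_(i+1)^a leads: for l > i both r and [psum A l] grow, for l <= i
    only r does. *)
Lemma weight_thetaE i : i < n ->
  weight_theta i = \sum_(l < n) (if i < l then 2 * l.+1 else 2).
Proof.
move=> ltin; rewrite /weight_theta [RHS](bigID (fun l : 'I_n => i < l)) /=.
rewrite (bigD1 (Ordinal ltin)) //= addnC; congr (_ + _).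
  rewrite [RHS](eq_bigr (fun l : 'I_n => 2 * l.+1)) => [|l ->] //.
  by apply: eq_bigl => l; rewrite -val_eqE /=; lia.
rewrite [RHS](eq_bigr (fun=> 2)) => [|l /negbTE->] //.
rewrite (eq_bigl (fun l : 'I_n => l < i.+1)) => [|l]; last by rewrite -leqNgt.
rewrite sum_nat_const mulnC; congr (_ * _); symmetry.
rewrite -sum1_card -(big_ord_widen _ (fun=> 1)) //; rewrite sum1_card card_ord //.
Qed.

Lemma weightY A D i : D <= quo_sum A -> i < n ->
  (use_y A D i -> weight (A + shift i) D.+1 = weight A D + weight_theta i) /\
  (~~ use_y A D i -> weight (A + shift i) D.+1 < weight A D + weight_theta i).
Proof.
move=> DA ltin; rewrite /use_y /weight /weight_theta quo_sum_shift // subSS.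
under eq_bigr do rewrite psum_shift //; rewrite [in X in _ + X]big_mkcond /= -big_split /=.
split=> ri.
  apply: eq_bigr => l _; case: leqP => [/(psum_mono A)|_]; last by rewrite !addn0.
  by move=> le1; rewrite mulnDr muln1; lia.
rewrite (bigD1 (Ordinal ltin)) // [ltnRHS](bigD1 (Ordinal ltin)) //= leqnn.
rewrite -addSn leq_add //; first by rewrite mulnDr muln1; lia.
by apply: leq_sum => l _; case: (i <= l); rewrite ?mulnDr ?muln1 ?muln0; lia.
Qed.

Lemma weightX A D i : D <= quo_sum A -> i.+1 < n ->
  (~~ use_y A D i -> weight (A + shift i.+1) D = weight A D + weight_theta i) /\
  (use_y A D i -> weight (A + shift i.+1) D < weight A D + weight_theta i).
Proof.
move=> DA ltSin; have ltin := ltnW ltSin.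
rewrite /use_y /weight weight_thetaE // quo_sum_shift // subSn //.
under eq_bigr do rewrite psum_shift //; rewrite -big_split /=.
split=> ri.
  apply: eq_bigr => l _; case: ltnP => [_|/(psum_mono A)].
    by rewrite mulnDr muln1; lia.
  by move=> le1; rewrite addn0; lia.
rewrite (bigD1 (Ordinal ltin)) // [ltnRHS](bigD1 (Ordinal ltin)) //= ltnn.
rewrite -addSn leq_add //; first by rewrite addn0; lia.
by apply: leq_sum => l _; case: (i < l); rewrite ?mulnDr ?muln1 ?muln0; lia.
Qed.

End PartialSums.

Lemma exists_subset_card (T : finType) (X : {set T}) d :
  d <= #|X| -> exists2 V : {set T}, V \subset X & #|V| = d.
Proof.
move=> dX; exists [set x in take d (enum X)].
  by apply/subsetP => x; rewrite inE => /mem_take; rewrite mem_enum.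
rewrite cardsE; have /card_uniqP -> : uniq (take d (enum X)) by apply/take_uniq/enum_uniq.
by rewrite size_take -cardE; case: ltngtP dX.
Qed.

Lemma exists_submultinom n (m : 'X_{1..n}) d :
  d <= mdeg m -> exists2 m' : 'X_{1..n}, forall i, m' i <= m i & mdeg m' = d.
Proof.
elim: d => [|d IH] dm; first by exists 0%MM => [i|]; rewrite ?mnm0E ?mdeg0.
have [m' le_m' dm'] := IH (ltnW dm).
have [i lti] : exists i, m' i < m i.
  apply/existsP; apply: contraLR dm; rewrite negb_exists -leqNgt -dm' => /forallP h.
  by rewrite !mdegE leq_sum // => i _; rewrite leqNgt.
exists (m' + U_(i))%MM => [l|]; last by rewrite mdegD mdeg1 dm' addn1.
by rewrite mnmDE mnm1E; have := le_m' l; case: eqP => [<-|_]; lia.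
Qed.

Lemma mdeg_lt_exists n (m m' : 'X_{1..n}) : mdeg m' <= mdeg m -> m != m' ->
  exists i, m' i < m i.
Proof.
move=> dmm' ne; apply/existsP; apply: contraNT ne; rewrite negb_exists => /forallP h.
have le i : m i <= m' i by rewrite leqNgt.
apply/eqP/mnmP => i; apply/eqP; rewrite eqn_leq le /= leqNgt; apply/negP => lt.
move: dmm'; rewrite !mdegE (bigD1 i) // [leqRHS](bigD1 i) //= leqNgt => /negP; apply.
by rewrite -addSn leq_add // leq_sum.
Qed.

(** * The well-founded order on states *)

Section StateOrder.
Variables n a : nat.

(* (A, D, j) stands for the class modulo the K_(i,l) of the monomials with image
   x^A t^D in R[It] and with w-degree j. *)
Definition state : Type := 'X_{1..n} * nat * nat.
Implicit Types (st : state).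

(** States of equal positive w-degree are left incomparable: there the term x_(i+1)^a of theta_i
    already lowers the w-degree through L_(i+1). In w-degree 0 no step is possible, and the weight
    decides. *)
Definition lower st st' : Prop :=
  st.2 < st'.2 \/
  [/\ st.2 = 0, st'.2 = 0 & weight a st.1.1 st.1.2 < weight a st'.1.1 st'.1.2].

Lemma lower_wf : well_founded lower.
Proof.
suff wf j st : st.2 < j -> Acc lower st by move=> st; apply: (wf st.2.+1).
elim: j st => [|j IHj] st; first by rewrite ltn0.
rewrite ltnS => stj.
move Dw: (weight a st.1.1 st.1.2).+1 => w; move/eq_leq: Dw.
elim: w st stj => [|w IHw] st stj stw; first by rewrite ltn0 in stw.
constructor=> st' [lt|[e' e lt]]; first by apply: IHj; lia.
by apply: IHw; lia.
Qed.

Lemma lower_trans st st' st'' : lower st st' -> lower st' st'' -> lower st st''.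
Proof.
move=> [h|[h1 h2 h3]] [h'|[h1' h2' h3']].
- by left; lia.
- by left; lia.
- by left; lia.
- by right; split; lia.
Qed.
End StateOrder.

(* UU is the family of the sets U such that the form F_U is available. *)
Record form_family (n a b : nat) (UU : {set {set 'I_n}}) : Prop := FormFamily {
  family_small : forall U, U \in UU -> 0 < #|U| /\ (#|U|.-1 * b < a);
  family_set1 : forall i, [set i] \in UU;
  family_sub : forall U V : {set 'I_n}, U \in UU -> 0 < #|V| < #|U| -> V \in UU
}.

(** * Confluence of the rewriting steps *)

Section States.
Variables (n a b : nat) (UU : {set {set 'I_n}}).
Hypotheses (a_gt0 : 0 < a) (UUP : form_family a b UU).
Implicit Types (A : 'X_{1..n}) (D j u : nat) (U V : {set 'I_n}) (be : 'X_{1..n}).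

(* x^(A - j b - a be) y^be w^j is a monomial with image x^A t^D in R[It], and it is
   divisible by the first term of F_U. *)
Definition fits A D j U be : Prop :=
  mdeg be + j = D /\
  forall i, a * be i + (i \in U) * (a - #|U| * b) + j * b <= A i.

Definition has_rep A D j : Prop := exists be, fits A D j set0 be.

(** A step may use any representative [be], as the monomials of a state are congruent modulo the
    K_(i,l). *)
Definition step A D j u : Prop := exists U be,
  [/\ U \in UU, #|U| = u, u <= j & fits A D j U be].

Lemma fits0 A D j U be : fits A D j U be -> fits A D j set0 be.
Proof. by move=> [dbe h]; split=> // i; have := h i; rewrite inE; lia. Qed.

Lemma fits_set1 A D j i be : fits A D j set0 be -> a * be i + a + j * b <= A i ->
  fits A D j [set i] be.
Proof.
move=> [dbe h] hi; split=> // l; have := h l; rewrite !inE cards1.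
by case: eqP => [->|_]; lia.
Qed.

Lemma step_gt0 A D j u : step A D j u -> 0 < u <= j.
Proof. by move=> [U [be [/(family_small UUP)[U0 _] <- -> _]]]; rewrite U0. Qed.

Lemma step1 A D j i be : 0 < j -> fits A D j set0 be ->
  a * be i + a + j * b <= A i -> step A D j 1.
Proof.
move=> j0 fbe hi; exists [set i], be; split=> //.
- exact: (family_set1 UUP).
- exact: cards1.
- exact: fits_set1.
Qed.

Definition raise be U : 'X_{1..n} := [multinom be i + (i \in U) | i < n].

Lemma mdeg_raise be U : mdeg (raise be U) = mdeg be + #|U|.
Proof.
rewrite !mdegE; under eq_bigr do rewrite mnmE; rewrite big_split /=; congr (_ + _).
by rewrite -sum1_card [RHS]big_mkcond; apply: eq_bigr => i _; case: (i \in U).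
Qed.

Lemma fits_raise A D j U be : #|U| <= j -> fits A D j U be ->
  fits A D (j - #|U|) set0 (raise be U).
Proof.
move=> Uj [dbe h]; split=> [|i]; first by rewrite mdeg_raise; lia.
have := h i; rewrite mnmE inE mulnBl mulnDr; have := leq_mul2r b #|U| j.
by rewrite Uj orbT; case: (i \in U); lia.
Qed.

Lemma step_rep A D j u : step A D j u -> has_rep A D (j - u).
Proof. by move=> [U [be [_ <- uj /(fits_raise uj) fbe]]]; exists (raise be U). Qed.

(** With u = |U| and u' = |U'|, the condition of F_V at i in V after F_U is governed by a - (u'-u)b
    + (j-u)b = a - u'b + jb, as for F_U' before; here u'-u <= u'-1, so that (u'-u)b < a and the
    subtraction is exact. Outside V the condition is the one that holds after F_U. *)
Lemma fits_confluent A D j U U' be : U \in UU -> U' \in UU ->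
  #|U| < #|U'| <= j -> fits A D j U be -> fits A D j U' be ->
  step A D (j - #|U|) (#|U'| - #|U|).
Proof.
move=> UUU UUU' /andP[ltUU' U'j] [dbe h] [_ h'].
have [V /subsetP VU' cV] : exists2 V : {set 'I_n}, V \subset U' :\: U & #|V| = #|U'| - #|U|.
  by apply: exists_subset_card; have := cardsID U U'; have := subset_leq_card (subsetIr U' U); lia.
have [U0 Ub] := family_small UUP UUU; have [U'0 U'b] := family_small UUP UUU'.
exists V, (raise be U); split=> //; last 2 first.
- by lia.
- split=> [|i]; first by rewrite mdeg_raise; lia.
  rewrite mnmE cV; have := h i; have := h' i.
  have l1 : #|U| * b <= #|U'|.-1 * b by rewrite leq_mul2r; lia.
  have l2 : #|U'| * b <= j * b by rewrite leq_mul2r; lia.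
  have l3 : #|U| * b <= #|U'| * b by rewrite leq_mul2r; lia.
  have l4 : (#|U'| - #|U|) * b <= #|U'|.-1 * b by rewrite leq_mul2r; lia.
  have hV : i \in V -> (i \in U') && (i \notin U).
    by move=> /VU'; rewrite !inE andbC.
  rewrite !mulnBl in l4 *; rewrite mulnDr; move: Ub U'b l1 l2 l3 l4 hV.
  move: (#|U'| * b) (#|U| * b) (j * b) (#|U'|.-1 * b) (a * be i) => p q r s t.
  move: (i \in V) (i \in U') (i \in U) (A i); clear.
  by move=> [] [] [] N; rewrite ?muln1 ?muln0 ?mul1n ?mul0n /=; lia.
by apply: (family_sub UUP UUU'); lia.
Qed.

Inductive reach A D : nat -> nat -> Prop :=
| reach_refl j : reach A D j j
| reach_step j u j' : step A D j u -> reach A D (j - u) j' -> reach A D j j'.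

Definition irr A D j : Prop := forall u, ~ step A D j u.

Lemma reach_leq A D j j' : reach A D j j' -> j' <= j.
Proof. by elim=> // {}j u {}j' _ _ /leq_trans; apply; rewrite leq_subr. Qed.

Lemma reach_trans A D j j' j'' : reach A D j j' -> reach A D j' j'' -> reach A D j j''.
Proof. by elim=> // {}j u {}j' st _ IH /IH; apply: reach_step. Qed.

Lemma reach_inv A D j j' : reach A D j j' ->
  j' = j \/ exists2 v, step A D j v & reach A D (j - v) j'.
Proof. by case=> [{}j|{}j u {}j' su ru]; [left | right; exists u]. Qed.

Lemma reach_irr A D j j' : irr A D j -> reach A D j j' -> j' = j.
Proof. by move=> ir rj; case: rj ir => // {}j u {}j' st _ /(_ u). Qed.

Lemma reach_rep A D j j' : reach A D j j' -> has_rep A D j -> has_rep A D j'.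
Proof. by elim=> // {}j u {}j' st _ IH _; apply/IH/step_rep/st. Qed.

(* If the two steps use different representatives, then x_i^a divides the second one
   for some i; so L_i applies to it and u = 1 by minimality. *)
Lemma step_confluent A D j u v : step A D j u -> step A D j v ->
  (forall w, step A D j w -> u <= w) -> u < v -> step A D (j - u) (v - u).
Proof.
move=> su [U' [be [UU' cU' vj fU']]] umin uv.
have [U [be' [UUU cU uj fU]]] := su.
have [ebe|nbe] := eqVneq be' be.
  by rewrite -cU -cU'; apply: (@fits_confluent A D j U U' be);
    rewrite ?cU ?cU' ?uv -?ebe //; rewrite ebe.
have [|i lti] := @mdeg_lt_exists _ be' be _ nbe.
  by case: fU fU' => [d _] [d' _]; lia.
have j0 : 0 < j by lia.
have [_ /(_ i) hi] := fU.
have f1 : fits A D j [set i] be.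
  apply: fits_set1; first exact: fits0 fU'.
  have : a * be i + a <= a * be' i by rewrite -mulnSr leq_mul2l lti orbT.
  by lia.
have u1 : u = 1.
  apply/eqP; rewrite eqn_leq; have /andP[-> _] := step_gt0 su; rewrite andbT umin //.
  by exists [set i], be; rewrite cards1; split=> //; exact: (family_set1 UUP).
rewrite u1 -(cards1 i) -cU'; apply: (@fits_confluent A D j _ _ be) => //.
  exact: (family_set1 UUP).
by rewrite cards1 cU' vj andbT -u1.
Qed.

(** Let u be the least size of a step from j. By [step_confluent] any other step, to j - v, can be
    continued from j - u. So all that is reachable from j, except j itself, is reachable from j - u,
    and induction applies there. *)
Lemma bottom A D j : exists j', forall j'', reach A D j j'' -> reach A D j'' j'.
Proof.
have [m] := ubnP j; elim: m j => // m IH j jm.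
have [st|nst] := pselect (exists u, step A D j u); last first.
  exists j => j'' rj; rewrite (reach_irr _ rj) //; first exact: reach_refl.
  by move=> u su; apply: nst; exists u.
have ex : exists u, `[< step A D j u >] by case: st => u su; exists u; apply/asboolP.
have [u /asboolP su umin] := ex_minnP ex.
have /andP[u0 uj] := step_gt0 su.
have {}umin w : step A D j w -> u <= w by move=> sw; apply/umin/asboolP.
have [|j' j'P] := IH (j - u); first by lia.
have rj' : reach A D (j - u) j' by apply/j'P/reach_refl.
exists j' => j'' /reach_inv[->|[v sv rv]]; first exact: reach_step su _.
have := umin _ sv; rewrite leq_eqVlt => /orP[/eqP e|uv].
  by apply: j'P; rewrite e.
apply/j'P/(reach_step (step_confluent su sv umin uv)).
by rewrite (_ : j - u - (v - u) = j - v) //; lia.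
Qed.

Definition nu A D j : nat := projT1 (cid (bottom A D j)).

Lemma nuP A D j j' : reach A D j j' -> reach A D j' (nu A D j).
Proof. exact: (projT2 (cid (bottom A D j))). Qed.

Lemma nu_reach A D j : reach A D j (nu A D j).
Proof. exact/nuP/reach_refl. Qed.

Lemma nu_leq A D j : nu A D j <= j.
Proof. exact/reach_leq/nu_reach. Qed.

Lemma nu_irr A D j : irr A D (nu A D j).
Proof.
move=> u su; have /andP[u0 uj] := step_gt0 su.
have /nuP/reach_leq : reach A D j (nu A D j - u).
  by apply: reach_trans (nu_reach _ _ _) (reach_step su (reach_refl _ _ _)).
by lia.
Qed.

Lemma irr_nu A D j : irr A D j -> nu A D j = j.
Proof. by move=> /reach_irr; apply; apply: nu_reach. Qed.

Lemma reach_nu A D j j' : reach A D j j' -> nu A D j' = nu A D j.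
Proof.
move=> rj; apply/esym/reach_irr; first exact: nu_irr.
suff: reach A D (nu A D j') (nu A D j).
  by move=> r; rewrite (reach_irr (@nu_irr A D j') r); apply: reach_refl.
by apply: nuP; apply: reach_trans rj (nu_reach _ _ _).
Qed.

Lemma fits_add A A' D D' j j' U be be' : fits A D j U be -> fits A' D' j' set0 be' ->
  fits (A + A') (D + D') (j + j') U (be + be').
Proof.
move=> [d h] [d' h']; split=> [|i]; first by rewrite mdegD; lia.
by have := h i; have := h' i; rewrite !mnmDE inE; lia.
Qed.

Lemma reach_add A A' D D' j j' l : has_rep A' D' l -> reach A D j j' ->
  reach (A + A') (D + D') (j + l) (j' + l).
Proof.
move=> [be' f']; elim=> [{}j|{}j u {}j' su _ IH]; first exact: reach_refl.
have /andP[_ uj] := step_gt0 su.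
apply: (@reach_step _ _ _ u); last by rewrite -addnBAC.
have [U [be [UUU cU _ f]]] := su.
by exists U, (be + be')%MM; split=> //; [lia | apply: fits_add].
Qed.

(** Steps survive multiplication by a monomial, so the normal form of a product depends only on the
    normal forms of its factors. *)
Lemma nu_add A A' D D' j j' l : has_rep A' D' l -> nu A D j = nu A D j' ->
  nu (A + A') (D + D') (j + l) = nu (A + A') (D + D') (j' + l).
Proof.
move=> rA' e; rewrite -(reach_nu (reach_add rA' (nu_reach A D j))).
by rewrite -(reach_nu (reach_add rA' (nu_reach A D j'))) e.
Qed.



(** If j > 0 and x_i^a were left in the x-part, L_i would apply. Hence an irreducible state of
    positive w-degree has a single representative. *)
Lemma fits_irr A D j be i : irr A D j -> 0 < j -> fits A D j set0 be ->
  be i = (A i - j * b) %/ a /\ A i < a * be i + a + j * b.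
Proof.
move=> ir j0 f; have lt : A i < a * be i + a + j * b.
  by rewrite ltnNge; apply/negP => /(step1 j0 f); apply: ir.
split=> //; have [_ /(_ i)] := f; rewrite inE mul0n addn0 => le.
apply/eqP; rewrite eqn_leq; apply/andP; split.
  by rewrite leq_divRL // mulnC; lia.
by rewrite -ltnS ltn_divLR // mulSn mulnC; lia.
Qed.

Lemma has_rep_shift A D j (i : 'I_n) : has_rep A D j ->
  has_rep (A + shift n a i) D.+1 j /\ has_rep (A + shift n a i) D j.
Proof.
move=> [be [d h]]; split.
  exists (be + U_(i))%MM; split=> [|l]; first by rewrite mdegD mdeg1; lia.
  have := h l; rewrite !mnmDE mnm1E mnmE mulnDr val_eqE eq_sym.
  by case: (l == i); lia.
by exists be; split=> // l; have := h l; rewrite mnmDE; lia.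
Qed.

(** A step on the product whose representative contains y_i comes from a step before the
    multiplication. If y_i is absent, comparing degrees gives some l other than i where the
    representative has more y_l than [be]; then x_l^a was left over, against [fits_irr]. *)
Lemma irr_shift A D j (i : 'I_n) : irr A D j -> 0 < j -> has_rep A D j ->
  irr (A + shift n a i) D.+1 j.
Proof.
move=> ir j0 [be f] u [U [be' [UUU cU uj [d' h']]]].
have [d h] := f.
have sU l : (U_(i)%MM : 'X_{1..n}) l = (l == i) by rewrite mnm1E eq_sym.
have [b'i|b'i] := posnP (be' i); last first.
  apply: (ir u); exists U, (be' - U_(i))%MM; split=> //; split=> [|l].
    have : mdeg (be' - U_(i) + U_(i)) = mdeg be'.
      by congr mdeg; apply/mnmP => l; rewrite mnmDE mnmBE sU; case: eqP => [->|_]; lia.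
    by rewrite mdegD mdeg1; lia.
  have := h' l; rewrite mnmDE mnmE mnmBE sU mulnBr val_eqE; case: eqP => [->|_]; last by lia.
  have : a <= a * be' i by rewrite leq_pmulr.
  by lia.
have [||l lt] := @mdeg_lt_exists _ be' be; first by lia.
  by apply/eqP => e; move: d'; rewrite e; lia.
have li : l != i by apply/eqP => e; move: lt; rewrite e b'i.
have [_] := fits_irr l ir j0 f; have := h' l.
rewrite mnmDE mnmE val_eqE (negbTE li).
have : a * be l + a <= a * be' l by rewrite -mulnSr leq_mul2l lt orbT.
by lia.
Qed.

(** L_i applies after multiplication by x_i^a, so the w-degree drops. This is why y_i is the leading
    term of theta_i in positive w-degree. *)
Lemma step_shift A D j (i : 'I_n) : 0 < j -> has_rep A D j ->
  step (A + shift n a i) D j 1.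
Proof.
move=> j0 [be [d h]]; apply: (@step1 _ _ _ i be) => //.
  by split=> // l; have := h l; rewrite mnmDE; lia.
by have := h i; rewrite mnmDE mnmE eqxx; lia.
Qed.

Lemma nu_step_lt A D j u : step A D j u -> nu A D j < j.
Proof.
move=> su; have := nu_leq A D (j - u); have /andP[u0 uj] := step_gt0 su.
by rewrite (reach_nu (reach_step su (reach_refl _ _ _))); lia.
Qed.

Lemma irr0 A D : irr A D 0.
Proof. by move=> u /step_gt0; lia. Qed.

Lemma has_rep0 A D : has_rep A D 0 <-> D <= quo_sum a A.
Proof.
split=> [[be [<- h]]|DA].
  rewrite addn0 mdegE; apply: leq_sum => i _; have := h i.
  by rewrite inE leq_divRL // mulnC; lia.
have [|be le dbe] := @exists_submultinom n [multinom A i %/ a | i < n] D.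
  by rewrite mdegE; under eq_bigr do rewrite mnmE.
exists be; split=> [|i]; first by rewrite dbe addn0.
rewrite inE mul0n !addn0 (leq_trans _ (leq_trunc_div (A i) a)) // mulnC leq_mul2r.
by have := le i; rewrite mnmE => ->; rewrite orbT.
Qed.

(** * The action of the theta_i on normal states *)

Implicit Types (st : state n).

Definition normal st := has_rep st.1.1 st.1.2 st.2 /\ irr st.1.1 st.1.2 st.2.
Definition normalize st : state n := (st.1, nu st.1.1 st.1.2 st.2).
Definition times_y (i : nat) st : state n := (st.1.1 + shift n a i, st.1.2.+1, st.2)%MM.
Definition times_xa (i : nat) st : state n := (st.1.1 + shift n a i, st.1.2, st.2)%MM.

Definition leads_y (i : 'I_n) st : bool := (0 < st.2) || use_y a st.1.1 st.1.2 i.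
Definition next_state (i : 'I_n) st : state n :=
  if leads_y i st then times_y i st else times_xa i.+1 st.
(** In positive w-degree this is the y_i-exponent of the unique representative, see [fits_irr]. *)
Definition expo (i : 'I_n) st : nat :=
  if 0 < st.2 then (st.1.1 i - st.2 * b) %/ a else exponent a st.1.1 st.1.2 i.
Definition core_state st : state n :=
  ((st.1.1 - \sum_i shift n a (if leads_y i st then i : nat else i.+1) *+ expo i st)%MM,
   st.1.2 - \sum_i expo i st * leads_y i st, st.2).

Lemma normal0 st : normal st -> st.2 = 0 -> st.1.2 <= quo_sum a st.1.1.
Proof. by move=> [+ _] e; rewrite e => /has_rep0. Qed.

Lemma normalize_normal st : has_rep st.1.1 st.1.2 st.2 -> normal (normalize st).
Proof.
by move=> r; split; [apply: reach_rep (nu_reach _ _ _) r | apply: nu_irr].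
Qed.

Lemma normalize_id st : normal st -> normalize st = st.
Proof. by case: st => [[A D] j] [_ /irr_nu e]; rewrite /normalize e. Qed.

Lemma next_succ i st : normal st -> ~~ leads_y i st -> i.+1 < n.
Proof.
move=> nst; rewrite negb_or -eqn0Ngt => /andP[/eqP/(normal0 nst) DA].
exact: use_y_next.
Qed.

Lemma next_normal i st : normal st -> normal (next_state i st).
Proof.
move=> nst; have := nst; case: st nst => [[A D] j] nst [r ir].
rewrite /next_state; case: ifP => ly; last first.
  have lti := next_succ nst (negbT ly).
  move: ly; rewrite /leads_y /=; case: posnP => //= j0 _.
  by subst j; split; [case: (has_rep_shift (Ordinal lti) r) | apply: irr0].
have [r' _] := has_rep_shift i r; split=> //=.
by case: (posnP j) ir r => [-> *|j0 ir r]; [apply: irr0 | apply: irr_shift].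
Qed.

Lemma next_w i st : (next_state i st).2 = st.2.
Proof. by rewrite /next_state; case: ifP. Qed.

Lemma leads_y_next i l st : normal st -> leads_y l (next_state i st) = leads_y l st.
Proof.
case: st => [[A D] j] nst; rewrite /leads_y next_w /=.
case: (posnP j) => // j0; rewrite /next_state /leads_y /=.
have DA := normal0 nst j0; rewrite j0 /=; case: ifP => [ri|/negbT ri] /=.
  exact: use_y_shiftY.
exact: use_y_shiftX.
Qed.

Lemma expo_next i l st : normal st -> expo l (next_state i st) = expo l st + (l == i).
Proof.
case: st => [[A D] j] nst; rewrite /expo next_w /=.
case: (posnP j) => j0; rewrite /next_state /leads_y /= -val_eqE.
  have DA := normal0 nst j0; rewrite j0 /=; case: ifP => [ri|/negbT ri] /=.
    exact: exponent_shiftY.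
  exact: exponent_shiftX.
rewrite j0 /= mnmDE mnmE; have [[be [_ /(_ l) h]] _] := nst.
move: h; rewrite /= inE mul0n addn0 => h; rewrite addnC -addnBA; last by lia.
by case: eqP => _; rewrite ?muln0 ?muln1 ?addn0 // divnDl // divnn a_gt0 addnC.
Qed.

Lemma sum_indicator (F : 'I_n -> nat) (i : 'I_n) : \sum_l F l * (l == i) = F i.
Proof.
rewrite (bigD1 i) //= eqxx muln1 big1 ?addn0 // => l /negbTE->.
by rewrite muln0.
Qed.

(** [next_state i] raises [expo i] alone, by 1, and does not change [leads_y]; so the amount
    subtracted grows exactly as the state does. *)
Lemma core_next i st : normal st -> core_state (next_state i st) = core_state st.
Proof.
move=> nst; rewrite /core_state next_w; congr (_, _, _).
  apply/mnmP => l; rewrite !mnmBE !mnm_sumE.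
  under eq_bigr do rewrite mulmnE leads_y_next // expo_next // mulnDr.
  rewrite big_split /= sum_indicator; under [in RHS]eq_bigr do rewrite mulmnE.
  by rewrite /next_state; case: ifP => ly; rewrite mnmDE subnDr.
under eq_bigr do rewrite leads_y_next // expo_next // mulnC mulnDr.
rewrite big_split /= sum_indicator; under [in RHS]eq_bigr do rewrite mulnC.
by rewrite /next_state; case: ifP => ly /=; rewrite ?addn0 // -add1n addnC subnDr.
Qed.

Lemma core_id st : (forall i, expo i st = 0) -> core_state st = st.
Proof.
case: st => [[A D] j] e0; rewrite /core_state /=; congr (_, _, _).
  by apply/mnmP => l; rewrite mnmBE big1 ?mnm0E ?subn0 // => i _; rewrite e0 mulm0n.
by rewrite big1 ?subn0 // => i _; rewrite e0.
Qed.

(** In w-degree 0 a positive [exponent] provides a block of index i or i+1 to remove. In positive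
    w-degree one y_i is removed; a step on what remains would give a step on [st]. *)
Lemma next_prev i st : normal st -> 0 < expo i st ->
  exists2 st', normal st' & next_state i st' = st.
Proof.
case: st => [[A D] j] nst; have [r ir] := nst; rewrite /expo /=.
case: (posnP j) => [j0|j0] /=.
  subst j; have DA : D <= quo_sum a A by apply: (normal0 nst).
  rewrite /exponent /=; case: (leqP (quo_sum a A - D)) => ri e0.
    have [A' eA lt] : exists2 A', A = (A' + shift n a i)%MM & i < n.
      by apply: subshift => //; lia.
    have DA' := psum_leq a A i; rewrite /= in DA'.
    move: DA ri e0 DA'; rewrite eA quo_sum_shift // psum_shift // leqnn => DA ri e0 DA'.
    exists (A', D.-1, 0).
      by split; [apply/has_rep0 => /=; lia | apply: irr0].
    rewrite /next_state /leads_y /= /use_y ifT.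
      by rewrite /times_y /= prednK //; lia.
    by lia.
  have [A' eA lt] : exists2 A', A = (A' + shift n a i.+1)%MM & i.+1 < n.
    by apply: subshift => //; lia.
  move: DA ri e0; rewrite eA quo_sum_shift // psum_shift // ltnn addn0 => DA ri e0.
  exists (A', D, 0).
    by split; [apply/has_rep0 => /=; lia | apply: irr0].
  by rewrite /next_state /leads_y /= /use_y ifF //; apply/negbTE; rewrite -ltnNge; lia.
have [be f] := r; have [<- _] := fits_irr i ir j0 f => be0.
have [d h] := f; rewrite /= in d h.
have a_le : a <= a * be i by rewrite leq_pmulr.
have [A' eA _] : exists2 A', A = (A' + shift n a i)%MM & i < n.
  apply: subshift => //; rewrite quo_ord divn_gt0 //.
  by have := h i; lia.
have sU l : (U_(i)%MM : 'X_{1..n}) l = (l == i :> nat) by rewrite mnm1E eq_sym.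
have [be' ebe] : exists be', be = (be' + U_(i))%MM.
  exists (be - U_(i))%MM; apply/mnmP => l; rewrite mnmDE mnmBE sU val_eqE.
  by case: eqP => [->|_]; lia.
have dbe : (mdeg be').+1 + j = D by move: d; rewrite ebe mdegD mdeg1; lia.
have fU : fits (shift n a i) 1 0 set0 U_(i)%MM.
  by split=> [|l]; rewrite ?mdeg1 // sU mnmE inE; lia.
have f' : fits A' D.-1 j set0 be'.
  split=> [|l]; first by rewrite -dbe.
  have := h l; rewrite eA ebe !mnmDE sU mnmE inE; lia.
have D0 : D = D.-1 + 1 by rewrite -dbe addn1.
exists (A', D.-1, j); last first.
  by rewrite /next_state /leads_y /= j0 /times_y /= -eA -addn1 -D0.
split=> [|u [U [be'' [UUU cU uj f'']]]]; first by exists be'.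
apply: (ir u); exists U, (be'' + U_(i))%MM; split=> //=.
by rewrite eA D0 -[j]addn0; apply: fits_add.
Qed.

(** The other term of theta_i falls below the leading one: in w-degree by [step_shift] if j > 0, in
    weight by [weightX] or [weightY] if j = 0. *)
Lemma normalize_lower i st :
  normal st -> has_rep st.1.1 st.1.2 st.2 ->
  (leads_y i st -> [/\ normalize (times_y i st) = next_state i st &
     (i.+1 < n -> lower a (normalize (times_xa i.+1 st)) (next_state i st))]) /\
  (~~ leads_y i st -> [/\ normalize (times_xa i.+1 st) = next_state i st &
     lower a (normalize (times_y i st)) (next_state i st)]).
Proof.
case: st => [[A D] j] nst /= r; have N := next_normal i nst.
split=> ly.
  have e : next_state i (A, D, j) = times_y i (A, D, j) by rewrite /next_state ly.
  rewrite -e normalize_id //; split=> // lti; rewrite e.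
  case: (posnP j) => [j0|j0].
    have DA := normal0 nst j0; subst j; right; split=> //=.
      by apply/eqP; rewrite -leqn0 nu_leq.
    have [_ lX] := @weightX n a a_gt0 A D i DA lti.
    by have [-> // _] := @weightY n a a_gt0 A D i DA (ltn_ord i); apply: lX.
  left; have := @step_shift A D j (Ordinal lti) j0 r => /nu_step_lt; exact.
have lti := next_succ nst ly.
have e : next_state i (A, D, j) = times_xa i.+1 (A, D, j) by rewrite /next_state (negbTE ly).
rewrite -e normalize_id //; split=> //; rewrite e; move: ly; rewrite /leads_y /=.
case: (posnP j) => //= j0 ly; have DA := normal0 nst j0; subst j; right; split=> //=.
  by apply/eqP; rewrite -leqn0 nu_leq.
have [_ lY] := @weightY n a a_gt0 A D i DA (ltn_ord i).
by have [-> // _] := @weightX n a a_gt0 A D i DA lti; apply: lY.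
Qed.

(** Normalization cannot raise the w-degree, which settles the case of a smaller one. Otherwise both
    w-degrees are 0: either product adds at most [weight_theta i] to the weight of [st'], and the
    leading product adds exactly this to that of [st]. *)
Lemma lower_next (i : 'I_n) st st' : normal st -> normal st' -> lower a st' st ->
  lower a (normalize (times_y i st')) (next_state i st) /\
  (i.+1 < n -> lower a (normalize (times_xa i.+1 st')) (next_state i st)).
Proof.
move=> nst nst' [lt|[e' e lt]].
  by split=> [|_]; left; rewrite next_w; apply: leq_ltn_trans lt; apply: nu_leq.
have DA := normal0 nst e; have DA' := normal0 nst' e'.
have wn : weight a (next_state i st).1.1 (next_state i st).1.2 =
    weight a st.1.1 st.1.2 + weight_theta n i.
  rewrite /next_state; case: ifP => [|/negbT] ly.
    move: ly; rewrite /leads_y e /= => ly.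
    by have [-> // _] := @weightY n a a_gt0 st.1.1 st.1.2 i DA (ltn_ord i).
  have lti := next_succ nst ly; move: ly; rewrite /leads_y e /= => ly.
  by have [-> // _] := @weightX n a a_gt0 st.1.1 st.1.2 i DA lti.
split=> [|lti]; right; rewrite next_w /= e e'; split=> //;
  try by apply/eqP; rewrite -leqn0 nu_leq.
  rewrite wn; have [h1 h2] := @weightY n a a_gt0 st'.1.1 st'.1.2 i DA' (ltn_ord i).
  by case: (boolP (use_y a st'.1.1 st'.1.2 i)) => [/h1|/h2]; lia.
rewrite wn; have [h1 h2] := @weightX n a a_gt0 st'.1.1 st'.1.2 i DA' lti.
by case: (boolP (use_y a st'.1.1 st'.1.2 i)) => [/h2|/h1]; lia.
Qed.



(** * Uniqueness of the normal monomial with a given image in R[It] *)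

Section AllForms.
Hypothesis UU_all : forall U, (U \in UU) = (0 < #|U|) && (#|U|.-1 * b < a).

(** Otherwise the least u with a <= ub satisfies u <= j and u <= n. For |U| = u the first term of
    F_U is then w^u, so F_U applies. *)
Lemma irr_bound A D j : has_rep A D j -> irr A D j -> j * b < a \/ n * b < a.
Proof.
move=> [be f] ir.
have [lt|lej] := ltnP (j * b) a; first by left.
have [lt|len] := ltnP (n * b) a; first by right.
have ex : exists u, a <= u * b by exists j.
have [u ub umin] := ex_minnP ex.
have [uj un] : u <= j /\ u <= n by split; apply: umin.
have u0 : 0 < u by case: u ub {umin uj un} => //; lia.
have [|U _ cU] := @exists_subset_card _ [set: 'I_n] u; first by rewrite cardsT card_ord.
case: (ir u); exists U, be; split=> //.
  rewrite UU_all cU u0 ltnNge; apply/negP => /umin; lia.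
have [d h] := f; split=> // i; have := h i; rewrite inE cU.
by rewrite (_ : a - u * b = 0) ?muln0 //; lia.
Qed.

(* If j' < j, then F_V' applies to x^(A - j b - a be) y^be w^j for a set V' of indices
   at which the excess be' - be is maximal. *)
Lemma irr_unique_le A D j j' : has_rep A D j -> irr A D j -> has_rep A D j' -> j <= j'.
Proof.
move=> r ir [be' [d' h']]; rewrite leqNgt; apply/negP => lt.
have [be f] := r; have [d h] := f.
pose ex (i : 'I_n) := be' i - be i.
have sum_ex : j - j' <= \sum_i ex i.
  have : mdeg be' <= mdeg be + \sum_i ex i.
    by rewrite !mdegE -big_split /=; apply: leq_sum => i _; rewrite /ex; lia.
  by lia.
have n0 : 0 < n.
  by move: sum_ex; case: (posnP n) => // n0; rewrite big1 => [|i]; [lia | have := ltn_ord i; lia].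
have [M exM [i0 ei0]] : exists2 M, forall i, ex i <= M & exists i, ex i = M.
  have [|i e] := eq_bigmax ex; first by rewrite card_ord.
  by exists (\max_i ex i) => [i'|]; [apply: leq_bigmax | exists i].
pose V := [set i | ex i == M].
have M0 : 0 < M.
  rewrite lt0n; apply: contraL lt => /eqP M0; rewrite -leqNgt -subn_eq0.
  rewrite -leqn0 (leq_trans sum_ex) // big1 // => i _.
  by apply/eqP; rewrite -leqn0 -M0.
(* The excess is at most M on V and at most M - 1 elsewhere. *)
have sum_le : j - j' <= #|V| + n * M.-1.
  apply: leq_trans sum_ex _.
  have -> : #|V| + n * M.-1 = \sum_(i < n) ((ex i == M) + M.-1).
    rewrite big_split /= sum_nat_const card_ord; congr (_ + _).
    by rewrite -sum1_card big_mkcond; apply: eq_bigr => i _; rewrite inE; case: eqP.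
  by apply: leq_sum => i _; have := exM i; case: eqP => [->|]; lia.
have V0 : 0 < #|V| by apply/card_gt0P; exists i0; rewrite inE ei0.
have [V' /subsetP sV cV] := @exists_subset_card _ V (minn #|V| (j - j')) (geq_minl _ _).
have Vn : #|V| <= n by rewrite -[leqRHS]card_ord max_card.
have bnd := irr_bound r ir.
pose u := minn #|V| (j - j'); rewrite -/u in cV.
have ub : u * b < a.
  have uj : u * b <= j * b by rewrite leq_mul2r /u; lia.
  have un : u * b <= n * b by rewrite leq_mul2r /u; lia.
  by case: bnd => /(leq_ltn_trans _); apply.
(* This is the condition of F_V' at an index of V', where be' = be + M. If |V| <= j - j', it follows
   from (j - j')b < a when M >= 2, and from [sum_le] when M = 1 or nb < a. *)
have key : a + (j - j') * b <= a * M + u * b.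
  rewrite /u; case: (leqP #|V| (j - j')) => [le|lt']; last first.
    by rewrite leq_add2r leq_pmulr.
  case: bnd => bnd.
    have : (j - j') * b <= j * b by rewrite leq_mul2r; lia.
    have [M1|M1] := leqP M 1; last first.
      have : a * 2 <= a * M by rewrite leq_mul2l M1 orbT.
      by lia.
    have e : M = 1 by lia.
    move: sum_le; rewrite e muln0 muln1 addn0 => le2.
    by move=> _; rewrite leq_add2l leq_mul2r le2 orbT.
  have : (j - j') * b <= (#|V| + n * M.-1) * b by rewrite leq_mul2r sum_le orbT.
  rewrite mulnDl [n * _]mulnC -mulnA => le1.
  have : M.-1 * (n * b) <= M.-1 * a by rewrite leq_mul2l (ltnW bnd) orbT.
  have : a * M = M.-1 * a + a by rewrite -{1}(prednK M0) mulnS mulnC addnC.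
  by lia.
apply: (ir u); exists V', be; split=> //; last 2 first.
- by rewrite /u; lia.
- split=> // i; have := h i; have := h' i; rewrite !inE cV !mul0n !addn0.
  case Vi: (i \in V'); rewrite ?mul0n ?addn0 // mul1n.
  have /sV := Vi; rewrite inE /ex => /eqP exi.
  have -> : be' i = be i + M by lia.
  rewrite mulnDr; move: key; rewrite mulnBl.
  have : j' * b <= j * b by rewrite leq_mul2r ltnW ?orbT.
  by lia.
rewrite UU_all cV; apply/andP; split; first by rewrite /u; lia.
by apply: leq_ltn_trans ub; rewrite leq_mul2r leq_pred orbT.
Qed.

End AllForms.
End States.

Local Open Scope ring_scope.

(** * Regular sequences from leading terms *)

Lemma wf_irrefl (T : Type) (R : T -> T -> Prop) x : well_founded R -> ~ R x x.
Proof. by move=> wfR; elim/(well_founded_ind wfR): x => x IH Rxx; apply: (IH x). Qed.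

Lemma maximal_in_seq (T : eqType) (R : T -> T -> Prop) (s : seq T) :
  (forall x, ~ R x x) -> (forall x y z, R x y -> R y z -> R x z) ->
  s != [::] -> exists2 x, x \in s & {in s, forall y, ~ R x y}.
Proof.
move=> irr tr; elim: s => // x s IH _.
have [->|/IH[z zs zmax]] := eqVneq s [::].
  by exists x; rewrite ?inE // => y; rewrite inE => /eqP ->; apply: irr.
have [Rzx|nRzx] := pselect (R z x).
  exists x; first by rewrite inE eqxx.
  move=> y; rewrite inE => /orP[/eqP-> //|ys Rxy].
  by apply: (zmax y ys); apply: tr Rxy.
exists z; first by rewrite inE zs orbT.
by move=> y; rewrite inE => /orP[/eqP-> //|]; apply: zmax.
Qed.

Lemma sum_undup_partition (V : nmodType) (I J : eqType) (p : I -> J)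
    (F : I -> V) (s : seq I) :
  \sum_(x <- s) F x = \sum_(j <- undup (map p s)) \sum_(x <- s | p x == j) F x.
Proof.
under [RHS]eq_bigr do rewrite big_mkcond /=.
rewrite exchange_big /= big_seq [RHS]big_seq; apply: eq_bigr => x xs.
rewrite -big_mkcond /= (eq_bigl (pred1 (p x))) => [|j]; last by rewrite /= eq_sym.
by rewrite -big_filter filter_pred1_uniq ?undup_uniq ?mem_undup ?map_f // big_seq1.
Qed.

Section RegularFromNormalForm.
Variables (k : fieldType) (N : nat).
Notation S := {mpoly k[N]}.
Variable Z : S -> Prop.
Hypotheses (Z0 : Z 0) (ZD : forall f g, Z f -> Z g -> Z (f + g))
  (ZM : forall f g, Z g -> Z (f * g)).

Lemma Z_scale c f : Z f -> Z (c *: f).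
Proof. by rewrite -mul_mpolyC; apply: ZM. Qed.

Lemma Z_sub f g : Z f -> Z g -> Z (f - g).
Proof. by move=> Zf Zg; rewrite -scaleN1r; apply: ZD => //; apply: Z_scale. Qed.

Definition lincomb (I : Type) (e : I -> S) (L : seq (k * I)) : S :=
  \sum_(x <- L) x.1 *: e x.2.

(* [f] is congruent modulo [Z] to a linear combination of the [e i] with [P i] *)
Definition spanned (I : eqType) (P : I -> Prop) (e : I -> S) (f : S) : Prop :=
  exists2 L : seq (k * I), {in L, forall x, P x.2} & Z (f - lincomb e L).

Section Spanned.
Variables (I : eqType) (P : I -> Prop) (e : I -> S).

Lemma spanned_gen c i : P i -> spanned P e (c *: e i).
Proof.
move=> Pi; exists [:: (c, i)]; first by move=> x; rewrite inE => /eqP->.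
by rewrite /lincomb big_seq1 subrr.
Qed.

Lemma spannedZ0 f : Z f -> spanned P e f.
Proof. by exists [::] => //; rewrite /lincomb big_nil subr0. Qed.

Lemma spannedD f g : spanned P e f -> spanned P e g -> spanned P e (f + g).
Proof.
move=> [L PL ZL] [L' PL' ZL']; exists (L ++ L').
  by move=> x; rewrite mem_cat => /orP[/PL|/PL'].
by rewrite /lincomb big_cat /= opprD addrACA; apply: ZD.
Qed.

Lemma spanned_scale c f : spanned P e f -> spanned P e (c *: f).
Proof.
move=> [L PL ZL]; exists [seq (c * x.1, x.2) | x <- L].
  by move=> _ /mapP[x xL ->]; apply: (PL x).
rewrite /lincomb big_map; under eq_bigr do rewrite /= -scalerA.
by rewrite -scaler_sumr -scalerBr; apply: Z_scale.
Qed.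

Lemma spannedB f g : spanned P e f -> spanned P e g -> spanned P e (f - g).
Proof. by move=> sf sg; rewrite -scaleN1r; apply/spannedD/spanned_scale. Qed.

Lemma spanned_sum (J : eqType) (r : seq J) (F : J -> S) :
  {in r, forall i, spanned P e (F i)} -> spanned P e (\sum_(i <- r) F i).
Proof.
move=> sF; rewrite big_seq; apply: big_ind => //; first exact: spannedZ0.
exact: spannedD.
Qed.
End Spanned.

Lemma spanned_mull (I J : eqType) (P : I -> Prop) (Q : J -> Prop)
    (e : I -> S) (e' : J -> S) (h f : S) :
  (forall i, P i -> spanned Q e' (h * e i)) -> spanned P e f ->
  spanned Q e' (h * f).
Proof.
move=> PQ [L PL ZL].
have -> : h * f = h * (f - lincomb e L) + \sum_(x <- L) x.1 *: (h * e x.2).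
  rewrite mulrBr mulr_sumr; under [X in _ - X]eq_bigr do rewrite -scalerAr.
  by rewrite subrK.
apply: spannedD; first by apply/spannedZ0/ZM.
by apply: spanned_sum => x /PL Px; apply/spanned_scale/PQ.
Qed.

Lemma spanned_trans (I J : eqType) (P : I -> Prop) (Q : J -> Prop)
    (e : I -> S) (e' : J -> S) (f : S) :
  (forall i, P i -> spanned Q e' (e i)) -> spanned P e f -> spanned Q e' f.
Proof.
move=> PQ sf; rewrite -[f]mul1r; apply: spanned_mull sf => i Pi.
by rewrite mul1r; apply: PQ.
Qed.

Variables (B : eqType) (nf : 'X_{1..N} -> B).

(** These are the coordinates with respect to normal forms. Their vanishing on Z, [Z_nfcoef] below,
    says that the normal forms are independent modulo Z, while [Z_nf] says that monomials are
    congruent to their normal forms. *)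
Definition nfcoef (b : B) (f : S) : k := \sum_(m <- msupp f | nf m == b) f@_m.

Lemma nfcoef_sub b f (s : seq 'X_{1..N}) :
  uniq s -> {subset msupp f <= s} -> nfcoef b f = \sum_(m <- s | nf m == b) f@_m.
Proof.
move=> us sub; rewrite /nfcoef [RHS](bigID (mem (msupp f))) /= [X in _ + X]big1 ?addr0.
  rewrite -[LHS]big_filter -[RHS]big_filter; apply: perm_big; apply: uniq_perm.
  - exact/filter_uniq/msupp_uniq.
  - exact: filter_uniq.
  - move=> m; rewrite !mem_filter; case mf: (m \in msupp f); last by rewrite !andbF.
    by rewrite (sub _ mf) !andbT.
by move=> m /andP[_ /memN_msupp_eq0].
Qed.

Lemma nfcoefD b f g : nfcoef b (f + g) = nfcoef b f + nfcoef b g.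
Proof.
pose s := undup (msupp f ++ msupp g).
have us : uniq s by apply: undup_uniq.
rewrite !(@nfcoef_sub b _ s us) -?big_split /=.
- by apply: eq_bigr => m _; rewrite mcoeffD.
- by move=> m mg; rewrite mem_undup mem_cat mg orbT.
- by move=> m mf; rewrite mem_undup mem_cat mf.
- by move=> m /msuppD_le; rewrite mem_undup.
Qed.

Lemma nfcoefZ b c f : nfcoef b (c *: f) = c * nfcoef b f.
Proof.
rewrite (@nfcoef_sub b _ (msupp f)) ?msupp_uniq //; last exact: msuppZ_le.
by rewrite mulr_sumr; apply: eq_bigr => m _; rewrite mcoeffZ.
Qed.

Lemma nfcoef0 b : nfcoef b 0 = 0.
Proof. by rewrite -(scale0r 0) nfcoefZ mul0r. Qed.

Lemma nfcoefX b m : nfcoef b 'X_[m] = (nf m == b)%:R.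
Proof.
rewrite /nfcoef msuppX big_mkcond big_seq1 mcoeffX eqxx.
by case: (nf m == b).
Qed.

Lemma nfcoef_sum b (J : Type) (r : seq J) (F : J -> S) :
  nfcoef b (\sum_(i <- r) F i) = \sum_(i <- r) nfcoef b (F i).
Proof.
elim: r => [|x r IH]; first by rewrite !big_nil nfcoef0.
by rewrite !big_cons nfcoefD IH.
Qed.

Hypothesis Z_nfcoef : forall f b, Z f -> nfcoef b f = 0.

Notation X := (fun m : 'X_{1..N} => 'X_[m] : S).
Notation valid b := (exists m, nf m = b).

Variable R : B -> B -> Prop.
Hypotheses (Rwf : well_founded R) (Rtr : forall x y z, R x y -> R y z -> R x z).

Notation low b := (spanned (fun m => R (nf m) b) X).

Lemma low_nfcoef b b' f : low b f -> nfcoef b' f <> 0 -> R b' b.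
Proof.
move=> [L PL ZL] nz.
have /eqP: nfcoef b' f = nfcoef b' (lincomb X L).
  by rewrite -[f in LHS](subrK (lincomb X L)) nfcoefD Z_nfcoef // add0r.
rewrite nfcoef_sum; apply: contraPP => nR; apply/negP.
rewrite big_seq big1 ?(introN eqP nz) // => x xL.
rewrite nfcoefZ nfcoefX; case: eqP => [e|_]; last by rewrite mulr0.
by case: nR; rewrite -e; apply: PL.
Qed.

(* [nx i b] is the leading term of [theta i] times [b], [bt i b] is the number of
   times that [nx i] can be undone from [b], and [cr b] is what is left of [b] when
   all of them are undone. *)
Variables (n : nat) (theta : 'I_n -> S) (nx : 'I_n -> B -> B)
  (bt : 'I_n -> B -> nat) (cr : B -> B).
Hypotheses (Z_nf : forall m m', nf m = nf m' -> Z ('X_[m] - 'X_[m']))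
  (bt_nx : forall i l b, valid b -> bt l (nx i b) = (bt l b + (l == i))%N)
  (cr_nx : forall i b, valid b -> cr (nx i b) = cr b)
  (cr_id : forall b, valid b -> (forall i, bt i b = 0%N) -> cr b = b)
  (nx_prev : forall i b, valid b -> (0 < bt i b)%N ->
     exists2 b', valid b' & nx i b' = b)
  (nx_lead : forall i m, exists s m', [/\ s != 0, nf m' = nx i (nf m) &
     low (nx i (nf m)) (theta i * 'X_[m] - s *: 'X_[m'])])
  (nx_low : forall i m b, valid b -> R (nf m) b ->
     low (nx i b) (theta i * 'X_[m])).

Lemma nx_valid i b : valid b -> valid (nx i b).
Proof. by move=> [m <-]; have [s [m' [_ <- _]]] := nx_lead i m; exists m'. Qed.

Definition std (b : B) : 'X_{1..N} :=
  if pselect (valid b) is left h then projT1 (cid h) else 0%MM.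

Lemma nf_std b : valid b -> nf (std b) = b.
Proof. by rewrite /std; case: pselect => // h _; case: cid. Qed.

(* The [Theta b] with [b] valid form a basis of S/Z stable under the [theta i]. *)
Definition Theta (b : B) : S := \prod_i theta i ^+ bt i b * 'X_[std (cr b)].

Lemma Theta_nx i b : valid b -> Theta (nx i b) = theta i * Theta b.
Proof.
move=> vb; rewrite /Theta cr_nx // mulrA; congr (_ * _).
rewrite (bigD1 i) //= [in RHS](bigD1 i) //= bt_nx // eqxx addn1 exprS -!mulrA.
congr (_ * (_ * _)); apply: eq_bigr => l /negbTE li.
by rewrite bt_nx // li addn0.
Qed.

(** Induction on the number of factors theta: [nx_lead] gives the leading term after one more
    factor, and [nx_low] keeps the remainder lower. So the family [Theta] is triangular with respect
    to the normal forms. *)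
Lemma Theta_lead b : valid b ->
  exists s m, [/\ s != 0, nf m = b & low b (Theta b - s *: 'X_[m])].
Proof.
move Dd: (\sum_i bt i b)%N => d; elim: d b Dd => [|d IH] b Dd vb.
  have bt0 i : bt i b = 0%N.
    by apply/eqP; move/eqP: Dd; rewrite sum_nat_eq0 => /forallP/(_ i).
  exists 1, (std b); rewrite oner_eq0 nf_std //; split=> //; apply: spannedZ0.
  rewrite /Theta cr_id // scale1r big1 ?mul1r ?subrr // => i _.
  by rewrite bt0 expr0.
have [[i bi]|bt0] := pselect (exists i, (0 < bt i b)%N); last first.
  move: Dd; rewrite big1 // => i _; apply/eqP; rewrite -leqn0 leqNgt.
  by apply/negP => bi; apply: bt0; exists i.
have [b' vb' eb] := nx_prev vb bi; rewrite -eb.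
have /IH/(_ vb')[s [m [s0 em lm]]] : (\sum_l bt l b')%N = d.
  move: Dd; rewrite -eb (bigD1 i) //= bt_nx // eqxx addn1.
  rewrite [in X in _ -> X](bigD1 i) //=.
  rewrite (eq_bigr (fun l => bt l b')) => [|l /negbTE li]; last by rewrite bt_nx // li addn0.
  by rewrite addSn => -[].
have [s' [m' [s'0 em' lm']]] := nx_lead i m; rewrite em in em' lm'.
exists (s * s'), m'; split=> //; first by rewrite mulf_neq0.
rewrite Theta_nx // (_ : _ - _ = theta i * (Theta b' - s *: 'X_[m]) +
  s *: (theta i * 'X_[m] - s' *: 'X_[m'])); last first.
  by rewrite mulrBr scalerBr scalerAr scalerA addrA subrK.
apply: spannedD; last exact: spanned_scale.
by apply: spanned_mull lm => m'' Rm; apply: nx_low.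
Qed.

Notation Tspan := (spanned (fun b => valid b) Theta).

(** Well-founded induction along [R]: up to a nonzero scalar, a monomial differs from its [Theta] by
    lower monomials. *)
Lemma Theta_span f : Tspan f.
Proof.
suff TX m : Tspan 'X_[m].
  rewrite [f]mpolyE; apply: spanned_sum => m _; exact: spanned_scale.
have [b Db] : exists b, nf m = b by exists (nf m).
elim/(well_founded_ind Rwf): b m Db => b IH m Db.
have vb : valid b by exists m.
have [s [m' [s0 em' lm']]] := Theta_lead vb.
rewrite -[X in Tspan X](subrK 'X_[m']); apply: spannedD.
  by apply/spannedZ0/Z_nf; rewrite em'.
rewrite -['X_[m']]scale1r -(mulVf s0) -scalerA; apply: spanned_scale.
rewrite -[X in Tspan X](subKr (Theta b)); apply: spannedB.
  by rewrite -[X in Tspan X]scale1r; apply: spanned_gen.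
by apply: spanned_trans lm' => m'' Rm; apply: (IH (nf m'')).
Qed.

Definition coefL (L : seq (k * B)) (b : B) : k := \sum_(x <- L | x.2 == b) x.1.

Lemma lincomb_coefL L :
  lincomb Theta L = \sum_(b <- undup (map snd L)) coefL L b *: Theta b.
Proof.
rewrite /lincomb (sum_undup_partition snd); apply: eq_bigr => b _.
by rewrite scaler_suml; apply: eq_bigr => x /eqP->.
Qed.

(** For a maximal b1 with nonzero coefficient, only [Theta b1] contributes to the normal-form
    coordinate at b1, and its contribution is nonzero. *)
Lemma Theta_free L : {in L, forall x, valid x.2} -> Z (lincomb Theta L) ->
  forall b, coefL L b = 0.
Proof.
move=> vL; rewrite lincomb_coefL; set s := undup _ => ZL b; apply/eqP/negPn/negP => nb.
pose t := [seq b <- s | coefL L b != 0].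
have bs : b \in s.
  apply: contraNT nb; rewrite mem_undup => bL; rewrite /coefL big_seq_cond big1 //.
  by move=> x /andP[xL /eqP xb]; case/negP: bL; rewrite -xb map_f.
have [|b1] := @maximal_in_seq _ R t (fun x => @wf_irrefl _ _ x Rwf) Rtr.
  by apply: contraL isT => /eqP t0; have := in_nil b; rewrite -t0 mem_filter nb bs.
rewrite mem_filter => /andP[nb1 b1s] b1max.
have vs b' : b' \in s -> valid b'.
  by rewrite mem_undup => /mapP[x xL ->]; apply: vL.
have := Z_nfcoef b1 ZL; rewrite nfcoef_sum (bigD1_seq b1) ?undup_uniq //=.
rewrite big_seq_cond big1 ?addr0 => [|b' /andP[b's b'b1]]; last first.
  rewrite nfcoefZ; have [->|nb'] := eqVneq (coefL L b') 0; first by rewrite mul0r.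
  have [c [m [_ em lm]]] := Theta_lead (vs _ b's).
  rewrite -[Theta b'](subrK (c *: 'X_[m])) nfcoefD nfcoefZ nfcoefX em (negbTE b'b1).
  rewrite mulr0 addr0; have [->|/eqP nz] := eqVneq (nfcoef b1 (Theta b' - c *: 'X_[m])) 0.
    by rewrite mulr0.
  case: (b1max b'); first by rewrite mem_filter nb'.
  exact: low_nfcoef lm nz.
have [c [m [c0 em lm]]] := Theta_lead (vs _ b1s).
rewrite nfcoefZ -[Theta b1](subrK (c *: 'X_[m])) nfcoefD nfcoefZ nfcoefX em eqxx mulr1.
have [->|/eqP nz] := eqVneq (nfcoef b1 (Theta b1 - c *: 'X_[m])) 0.
  by rewrite add0r => /eqP; rewrite mulf_eq0 (negbTE nb1) (negbTE c0).
by case/(wf_irrefl Rwf): (low_nfcoef lm nz).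
Qed.

(** Equal images force equal [bt] and [cr], hence the same [Theta]; freeness then forbids b and b'
    to differ. *)
Lemma nx_inj i b b' : valid b -> valid b' -> nx i b = nx i b' -> b = b'.
Proof.
move=> vb vb' e; have TT : Theta b = Theta b'.
  rewrite /Theta -(cr_nx i vb) -(cr_nx i vb') e; congr (_ * _).
  apply: eq_bigr => l _; congr (_ ^+ _); apply: (@addIn (l == i)).
  by rewrite -!bt_nx // e.
apply/eqP/negPn/negP => nbb'.
have := @Theta_free [:: (1, b); (-1, b')] _ _ b.
rewrite /coefL big_mkcond big_cons big_seq1 /= eqxx [b' == b]eq_sym (negbTE nbb') addr0.
move=> h; case/eqP: (oner_neq0 k); apply: h.
  by move=> x; rewrite !inE => /orP[]/eqP->.
by rewrite /lincomb big_cons big_seq1 /= TT scaleN1r scale1r subrr.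
Qed.

Definition rep f : seq (k * B) := s2val (cid2 (Theta_span f)).

Lemma rep_valid f : {in rep f, forall x, valid x.2}.
Proof. exact: (s2valP (cid2 (Theta_span f))). Qed.

Lemma repP f : Z (f - lincomb Theta (rep f)).
Proof. exact: (s2valP' (cid2 (Theta_span f))). Qed.

Definition coord (b : B) (f : S) : k := coefL (rep f) b.

Lemma coordE L f : {in L, forall x, valid x.2} -> Z (f - lincomb Theta L) ->
  forall b, coord b f = coefL L b.
Proof.
move=> vL ZL b; apply/eqP; rewrite -subr_eq0; apply/eqP.
have := @Theta_free (rep f ++ [seq (- x.1, x.2) | x <- L]) _ _ b.
rewrite /coefL big_cat big_map /= sumrN; apply.
  move=> x; rewrite mem_cat => /orP[/rep_valid //|/mapP[y yL ->]]; exact: (vL y).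
rewrite /lincomb big_cat big_map /=.
under [X in _ + X]eq_bigr do rewrite scaleNr.
by rewrite sumrN; have := Z_sub ZL (repP f); rewrite opprB addrCA [f - _]addrC addrK.
Qed.

Lemma coordD b f g : coord b (f + g) = coord b f + coord b g.
Proof.
rewrite (@coordE (rep f ++ rep g)) /coefL ?big_cat //.
  by move=> x; rewrite mem_cat => /orP[]/rep_valid.
by rewrite /lincomb big_cat opprD addrACA; apply: ZD; apply: repP.
Qed.

Lemma coord_Z b f : Z f -> coord b f = 0.
Proof.
by move=> Zf; rewrite (@coordE [::]) /coefL ?big_nil // /lincomb big_nil subr0.
Qed.

Lemma lincomb_theta i L : {in L, forall x, valid x.2} ->
  theta i * lincomb Theta L = lincomb Theta [seq (x.1, nx i x.2) | x <- L].
Proof.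
move=> vL; rewrite /lincomb big_map mulr_sumr big_seq [RHS]big_seq.
by apply: eq_bigr => x xL /=; rewrite Theta_nx -?scalerAr //; apply: (vL x).
Qed.

Lemma coord_thetaE i b f :
  coord b (theta i * f) = \sum_(x <- rep f | nx i x.2 == b) x.1.
Proof.
rewrite (@coordE [seq (x.1, nx i x.2) | x <- rep f]) /coefL ?big_map //.
  by move=> _ /mapP[x xL ->]; apply/nx_valid/(rep_valid xL).
rewrite -lincomb_theta; last exact: rep_valid.
by rewrite -mulrBr; apply/ZM/repP.
Qed.

Lemma coord_theta i b f : valid b -> coord (nx i b) (theta i * f) = coord b f.
Proof.
move=> vb; rewrite coord_thetaE /coord /coefL big_seq_cond [RHS]big_seq_cond.
apply: eq_bigl => x; case xf: (x \in rep f) => //=.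
by apply/eqP/eqP => [|-> //]; apply: (nx_inj (rep_valid xf) vb).
Qed.

Lemma coord_theta_bt0 i b f : bt i b = 0%N -> coord b (theta i * f) = 0.
Proof.
move=> b0; rewrite coord_thetaE big_seq_cond big1 // => x /andP[xf /eqP xb].
by move: b0; rewrite -xb bt_nx ?eqxx ?addn1 //; apply: (rep_valid xf).
Qed.

Definition in_thetas (i : nat) (f : S) : Prop :=
  exists g : 'I_n -> S, Z (f - \sum_(l < n | (l < i)%N) theta l * g l).

(** theta_l shifts coordinates along [nx l], whose values have positive [bt l]; so a multiple of
    theta_l has coordinate 0 wherever [bt l] is 0. *)
Lemma coord_in_thetas i b f : in_thetas i f ->
  (forall l : 'I_n, (l < i)%N -> bt l b = 0%N) -> coord b f = 0.
Proof.
move=> [g Zg] b0; rewrite -[f](subrK (\sum_(l < n | (l < i)%N) theta l * g l)).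
rewrite coordD coord_Z // add0r.
elim/big_rec: _ => [|l h li IH]; first exact: coord_Z.
by rewrite coordD IH addr0 coord_theta_bt0 ?b0.
Qed.

Lemma in_thetasD i f g : in_thetas i f -> in_thetas i g -> in_thetas i (f + g).
Proof.
move=> [u Zu] [v Zv]; exists (fun l => u l + v l).
under eq_bigr do rewrite mulrDr.
by rewrite big_split opprD addrACA; apply: ZD.
Qed.

Lemma in_thetas_Z i f : Z f -> in_thetas i f.
Proof.
by exists (fun=> 0); rewrite big1 ?subr0 // => l _; rewrite mulr0.
Qed.

Lemma in_thetas_mul (l : 'I_n) i g : (l < i)%N -> in_thetas i (theta l * g).
Proof.
move=> li; exists (fun l' => if l' == l then g else 0).
rewrite (bigD1 l) //= eqxx big1 ?addr0 ?subrr // => l' /andP[_ /negbTE->].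
by rewrite mulr0.
Qed.

(** Expand f in the basis [Theta]. If some [bt l b] with l < i is positive, [Theta b] is a multiple
    of theta_l. Otherwise the coordinate of f at b equals that of theta_i f at [nx i b], where all
    these [bt l] are still 0, so it vanishes by [coord_in_thetas]. *)
Lemma theta_regular (i : 'I_n) f : in_thetas i (theta i * f) -> in_thetas i f.
Proof.
move=> tf; rewrite -[f](subrK (lincomb Theta (rep f))).
apply: in_thetasD; first exact/in_thetas_Z/repP.
rewrite lincomb_coefL big_seq; elim/big_rec: _ => [|b g].
  exact/in_thetas_Z.
rewrite mem_undup => /mapP[x xL eb] IH; apply: in_thetasD => //.
have vb : valid b by rewrite eb; apply: rep_valid xL.
have [[l [li bl]]|b0] := pselect (exists l : 'I_n, (l < i)%N /\ (0 < bt l b)%N).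
  have [b' vb' <-] := nx_prev vb bl.
  by rewrite Theta_nx // scalerAr; apply: in_thetas_mul.
have bl0 (l : 'I_n) : (l < i)%N -> bt l b = 0%N.
  move=> li; apply/eqP; rewrite -leqn0 leqNgt; apply/negP => bl.
  by apply: b0; exists l.
rewrite -/(coord b f) -(coord_theta i f vb) (coord_in_thetas tf).
  by rewrite scale0r; apply: in_thetas_Z.
by move=> l li; rewrite bt_nx // bl0 // -val_eqE /= (ltn_eqF li).
Qed.

End RegularFromNormalForm.

(** * Monomials of S *)

Section Monomials.
Variables (n a b : nat).
Notation N := (n + n + 1)%N.
Implicit Types (m : 'X_{1..N}) (i l : 'I_n).

Definition ix i : 'I_N := lshift 1 (lshift n i).
Definition iy i : 'I_N := lshift 1 (rshift n i).
Definition iw : 'I_N := rshift (n + n) ord0.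

Lemma ord_cases (P : 'I_N -> Prop) :
  (forall i, P (ix i)) -> (forall i, P (iy i)) -> P iw -> forall v, P v.
Proof.
move=> Px Py Pw v; rewrite -(splitK v); case: (split v) => [v'|v'] /=.
  by rewrite -(splitK v'); case: (split v').
by rewrite ord1.
Qed.

Lemma prod_N (R : pzSemiRingType) (F : 'I_N -> R) :
  \prod_v F v = \prod_i F (ix i) * \prod_i F (iy i) * F iw.
Proof. by rewrite big_split_ord big_split_ord /= big_ord1. Qed.

Definition expy m : 'X_{1..n} := [multinom m (iy i) | i < n].
Definition mon_state m : state n :=
  ([multinom m (ix i) + a * m (iy i) + b * m iw | i < n]%N,
   (\sum_i m (iy i) + m iw)%N, m iw).

Definition mkmon (al be : 'X_{1..n}) (j : nat) : 'X_{1..N} :=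
  [multinom match split v with
   | inl v' => match split v' with inl i => al i | inr i => be i end
   | inr _ => j end | v < N].

Lemma mkmon_x al be j i : mkmon al be j (ix i) = al i.
Proof. by rewrite mnmE (unsplitK (inl _)) (unsplitK (inl _)). Qed.
Lemma mkmon_y al be j i : mkmon al be j (iy i) = be i.
Proof. by rewrite mnmE (unsplitK (inl _)) (unsplitK (inr _)). Qed.
Lemma mkmon_w al be j : mkmon al be j iw = j.
Proof. by rewrite mnmE (unsplitK (inr _)). Qed.

Lemma mnmP_N m m' : (forall i, m (ix i) = m' (ix i)) ->
  (forall i, m (iy i) = m' (iy i)) -> m iw = m' iw -> m = m'.
Proof. by move=> hx hy hw; apply/mnmP; apply: ord_cases. Qed.

Lemma fits_mon m :
  fits a b (mon_state m).1.1 (mon_state m).1.2 (mon_state m).2 set0 (expy m).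
Proof.
split=> [|i]; rewrite /= ?mdegE; first by under eq_bigr do rewrite mnmE.
by rewrite inE !mnmE; lia.
Qed.

Lemma mon_stateD m m' : mon_state (m + m') =
  (((mon_state m).1.1 + (mon_state m').1.1)%MM,
   (mon_state m).1.2 + (mon_state m').1.2, (mon_state m).2 + (mon_state m').2)%N.
Proof.
rewrite /mon_state /=; congr (_, _, _); last by rewrite mnmDE.
  by apply/mnmP => i; rewrite mnmDE !mnmE; lia.
under eq_bigr do rewrite mnmDE.
by rewrite big_split /= mnmDE; lia.
Qed.

Lemma ixE i i' : (ix i == ix i') = (i == i').
Proof. by apply/eqP/eqP => [/lshift_inj/lshift_inj|->]. Qed.
Lemma iyE i i' : (iy i == iy i') = (i == i').
Proof. by apply/eqP/eqP => [/lshift_inj/rshift_inj|->]. Qed.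
Lemma ixyE i i' : (ix i == iy i') = false.
Proof. by apply/eqP => /lshift_inj/eqP; rewrite eq_lrshift. Qed.
Lemma iyxE i i' : (iy i == ix i') = false.
Proof. by rewrite eq_sym ixyE. Qed.
Lemma ixwE i : (ix i == iw) = false.
Proof. by rewrite eq_lrshift. Qed.
Lemma iywE i : (iy i == iw) = false.
Proof. by rewrite eq_lrshift. Qed.

Definition ixyw := (ixE, iyE, ixyE, iyxE, ixwE, iywE).

Lemma mon_state_y i : mon_state U_(iy i) = (shift n a i, 1%N, 0%N).
Proof.
rewrite /mon_state mnm1E iywE; congr (_, _, _).
  by apply/mnmP => l; rewrite !mnmE !ixyw val_eqE [l == i]eq_sym; lia.
under eq_bigr do rewrite mnm1E iyE -[(_ == _) : nat]mul1n eq_sym.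
by rewrite sum_indicator.
Qed.

Lemma mon_state_xa i : mon_state (U_(ix i) *+ a) = (shift n a i, 0%N, 0%N).
Proof.
rewrite /mon_state mulmnE mnm1E ixwE; congr (_, _, _).
  by apply/mnmP => l; rewrite !mnmE !mulmnE !mnm1E !ixyw val_eqE [l == i]eq_sym; lia.
by rewrite big1 // => l _; rewrite mulmnE mnm1E ixyE.
Qed.

Lemma mon_state_mkmon al be j : mon_state (mkmon al be j) =
  ([multinom al i + a * be i + b * j | i < n], mdeg be + j, j)%N.
Proof.
rewrite /mon_state mkmon_w mdegE; congr (_, _, _); last first.
  by under eq_bigr do rewrite mkmon_y.
by apply/mnmP => i; rewrite mnmE mkmon_x mkmon_y mnmE.
Qed.

Lemma fits_mkmon st be : fits a b st.1.1 st.1.2 st.2 set0 be ->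
  mon_state (mkmon [multinom st.1.1 i - a * be i - st.2 * b | i < n]%N be st.2) = st.
Proof.
case: st => [[A D] j] /= [<- h]; rewrite mon_state_mkmon; congr (_, _, _).
apply/mnmP => i; rewrite !mnmE; have := h i.
by rewrite inE mul0n addn0 [(b * j)%N]mulnC; lia.
Qed.

Variable (UU : {set {set 'I_n}}).
Hypotheses (a_gt0 : (0 < a)%N) (UUP : form_family a b UU).

Notation norm := (normalize a_gt0 UUP).
Definition normal_form m : state n := norm (mon_state m).

Lemma mon_rep m : has_rep a b (mon_state m).1.1 (mon_state m).1.2 (mon_state m).2.
Proof. by exists (expy m); apply: fits_mon. Qed.

Lemma normal_nf m : normal a b UU (normal_form m).
Proof. exact/normalize_normal/mon_rep. Qed.

Lemma nfD m m' u : normal_form m = normal_form m' -> normal_form (m + u) = normal_form (m' + u).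
Proof.
move=> e; rewrite /normal_form /normalize !mon_stateD.
have eA : (mon_state m).1.1 = (mon_state m').1.1 by apply: (congr1 (fun st => st.1.1) e).
have eD : (mon_state m).1.2 = (mon_state m').1.2 by apply: (congr1 (fun st => st.1.2) e).
have ej : (normal_form m).2 = (normal_form m').2 by rewrite e.
move: ej; rewrite /normal_form /normalize [in LHS]eA [in LHS]eD => ej.
by rewrite eA eD; congr (_, _, _); apply: (nu_add (mon_rep u)).
Qed.

Lemma nf_onto st : normal a b UU st -> exists m, normal_form m = st.
Proof.
move=> nst; have [[be f] _] := nst.
exists (mkmon [multinom (st.1.1 i - a * be i - st.2 * b)%N | i < n] be st.2).
by rewrite /normal_form fits_mkmon // normalize_id.
Qed.

Lemma norm_addl st st' : has_rep a b st'.1.1 st'.1.2 st'.2 ->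
  norm (((norm st).1.1 + st'.1.1)%MM, (norm st).1.2 + st'.1.2, (norm st).2 + st'.2)%N =
  norm ((st.1.1 + st'.1.1)%MM, st.1.2 + st'.1.2, st.2 + st'.2)%N.
Proof.
move=> r; rewrite /normalize /=; congr (_, _, _).
apply: (nu_add r); rewrite irr_nu //; exact: nu_irr.
Qed.

Lemma nf_y m i : normal_form (m + U_(iy i)) = norm (times_y a i (normal_form m)).
Proof.
rewrite /normal_form mon_stateD mon_state_y -norm_addl /=; last first.
  by exists U_(i)%MM; split=> [|l]; rewrite ?mdeg1 // inE mnm1E mnmE val_eqE [l == i]eq_sym; lia.
by congr norm; congr (_, _, _); [exact: addn1 | exact: addn0].
Qed.

Lemma nf_xa m i : normal_form (m + U_(ix i) *+ a) = norm (times_xa a i (normal_form m)).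
Proof.
rewrite /normal_form mon_stateD mon_state_xa -norm_addl /=; last first.
  by exists 0%MM; split=> [|l]; rewrite ?mdeg0 // inE mnm0E; lia.
by congr norm; congr (_, _, _); exact: addn0.
Qed.

Variable k : fieldType.
Notation S := {mpoly k[N]}.

Definition theta i : S :=
  'X_[U_(iy i)] - (if insub i.+1 is Some l then 'X_[U_(ix l) *+ a] else 0).

Lemma theta_mulX i m : theta i * 'X_[m] = 'X_[m + U_(iy i)] -
  (if insub i.+1 is Some l then 'X_[m + U_(ix l) *+ a] else 0).
Proof.
rewrite /theta mulrBl -mpolyXD addmC; congr (_ - _).
by case: insubP => [l _ _|_]; rewrite ?mul0r // -mpolyXD addmC.
Qed.

Section Quotient.
Variable Z : S -> Prop.
Hypotheses (Z0 : Z 0) (ZD : forall f g, Z f -> Z g -> Z (f + g))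
  (ZM : forall f g, Z g -> Z (f * g))
  (Z_nf : forall m m', normal_form m = normal_form m' -> Z ('X_[m] - 'X_[m']))
  (Z_nfcoef : forall f st, Z f -> nfcoef normal_form st f = 0).

(** [theta_regular] for the order [lower], with [next_state] as multiplication by the leading term;
    the leading coefficient is 1 for y_i and -1 for x_(i+1)^a. *)
Lemma theta_seq_regular i f :
  in_thetas Z theta i (theta i * f) -> in_thetas Z theta i f.
Proof.
have vN st : (exists m, normal_form m = st) -> normal a b UU st.
  by move=> [m <-]; apply: normal_nf.
apply: (@theta_regular k N Z Z0 ZD ZM _ normal_form Z_nfcoef (lower a) (@lower_wf n a)
  (@lower_trans n a) n theta (next_state a) (expo a b) (core_state a b) Z_nf).
- by move=> i' l st /vN; apply: expo_next.
- by move=> i' st /vN; apply: core_next.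
- by move=> st _; apply: core_id.
- move=> i' st /vN nst /(next_prev a_gt0 UUP nst)[st' nst' e].
  by exists st' => //; apply: nf_onto.
- move=> i' m; have nm := normal_nf m.
  have [hY hX] := normalize_lower a_gt0 UUP i' nm nm.1.
  have [ly|ly] := boolP (leads_y a i' (normal_form m)).
    have [eN lX] := hY ly; exists 1, (m + U_(iy i'))%MM; rewrite oner_eq0 nf_y eN; split=> //.
    rewrite theta_mulX scale1r addrC addKr; case: insubP => [l lt el|_].
      rewrite -scaleN1r; apply: spanned_gen => //.
      by rewrite nf_xa el; apply: lX.
    by rewrite oppr0; apply: spannedZ0.
  have lti := next_succ a_gt0 nm ly; have [eN lY] := hX ly.
  exists (-1), (m + U_(ix (Ordinal lti)) *+ a)%MM; rewrite oppr_eq0 oner_eq0 nf_xa eN; split=> //.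
  rewrite theta_mulX insubT scaleN1r opprK subrK -['X_[_]]scale1r.
  by apply: spanned_gen => //; rewrite nf_y.
- move=> i' m st /vN nst lt.
  have [lY lX] := @lower_next _ _ b UU a_gt0 UUP i' _ _ nst (normal_nf m) lt.
  rewrite theta_mulX; apply: spannedB => //.
    by rewrite -['X_[_]]scale1r; apply: spanned_gen => //; rewrite nf_y.
  case: insubP => [l ltl el|_]; last exact: spannedZ0.
  by rewrite -['X_[_]]scale1r; apply: spanned_gen => //; rewrite nf_xa el; apply: lX.
Qed.

End Quotient.
End Monomials.

(** * Depth of a cyclic module with such normal forms *)

Section CyclicDepth.
Variables (k : fieldType) (n a b : nat) (UU : {set {set 'I_n}}).
Hypotheses (a_gt0 : (0 < a)%N) (UUP : form_family a b UU).
Notation N := (n + n + 1)%N.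
Notation S := {mpoly k[N]}.
Notation nf := (normal_form a_gt0 UUP).
Notation theta := (@theta n a k).

Lemma theta_maxS i : theta i \in maxS k n.
Proof.
have gX v : ('X_v : S) \in maxS k n by apply: gen_ideal_gen; exists v.
apply: rpredB; first exact: gX.
case: insubP => [l _ _|_]; last exact: rpred0.
rewrite -mpolyXn -(prednK a_gt0) exprSr; exact/gen_idealMl/gX.
Qed.

Lemma theta_at0 i : (theta i).@[fun=> 0] = 0.
Proof.
rewrite mevalB mevalXU sub0r; case: insubP => [l _ _|_]; last by rewrite meval0 oppr0.
by rewrite -mpolyXn rmorphXn /= mevalXU expr0n gtn_eqF // oppr0.
Qed.

Variables (M : lmodType (polS k n)) (v0 : M).
Hypothesis v0_gen : forall v : M, exists f : polS k n, v = f *: v0.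
Let Z (f : S) : Prop := (f : polS k n) *: v0 = 0.
Hypotheses (Z_nf : forall m m', nf m = nf m' -> Z ('X_[m] - 'X_[m']))
  (Z_nfcoef : forall f st, Z f -> nfcoef nf st f = 0)
  (Z_at0 : forall f, Z f -> f.@[fun=> 0] = 0).

Let s : seq (polS k n) := [seq theta i | i <- enum 'I_n].

Lemma size_thetas : size s = n.
Proof. by rewrite size_map size_enum_ord. Qed.

Lemma nth_thetas (i : 'I_n) : s`_i = theta i.
Proof. by rewrite (nth_map i) ?size_enum_ord // nth_ord_enum. Qed.

(** As v0 generates M, coefficients in M can be written g v0 with g in S; membership is then tested
    in S modulo the annihilator of v0. *)
Lemma in_seq_smul_thetas i (f : polS k n) : (i <= n)%N ->
  in_seq_smul (take i s) (f *: v0) <-> in_thetas Z theta i f.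
Proof.
move=> lein; have st : size (take i s) = i by rewrite size_takel // size_thetas.
have E (F : nat -> M) : \sum_(j < size (take i s)) (take i s)`_j *: F j =
    \sum_(l < n | (l < i)%N) (theta l : polS k n) *: F l.
  rewrite st; rewrite (big_ord_widen n (fun j => (take i s)`_j *: F j)) //.
  by apply: eq_bigr => l li; rewrite nth_take // nth_thetas.
split=> [[m em]|[g Zg]].
  pose mm j := if insub j is Some j' then m j' else 0.
  have [g mg] : exists g : 'I_n -> polS k n, forall l : 'I_n, mm l = g l *: v0.
    have h (l : 'I_n) : exists f, mm l = f *: v0 by apply: v0_gen.
    by exists (fun l : 'I_n => projT1 (cid (h l))) => l; case: cid.
  exists g; rewrite /Z scalerBl em.
  rewrite (eq_bigr (fun j : 'I_(size (take i s)) => (take i s)`_j *: mm j)) => [|j _].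
    rewrite E scaler_suml -sumrB big1 // => l _.
    by rewrite mg -scalerA subrr.
  by rewrite /mm valK.
pose gg j : polS k n := if insub j is Some l then g l else 0.
exists (fun j => gg j *: v0); rewrite (E (fun j => gg j *: v0)).
apply/eqP; rewrite -subr_eq0; apply/eqP; rewrite -[RHS]Zg scalerBl scaler_suml.
by congr (_ - _); apply: eq_bigr => l _; rewrite /gg valK scalerA.
Qed.

Lemma cyclic_depth_ge : depth_ge M (maxS k n) n.
Proof.
have Z0 : Z 0 by rewrite /Z scale0r.
have ZD f g : Z f -> Z g -> Z (f + g) by rewrite /Z scalerDl => -> ->; rewrite addr0.
have ZM f g : Z g -> Z (f * g) by rewrite /Z -scalerA => ->; rewrite scaler0.
exists s; split; first by rewrite size_thetas.
  by move=> _ /mapP[i _ ->]; apply: theta_maxS.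
split=> [i lti v|].
  rewrite size_thetas in lti; have [f ->] := v0_gen v.
  rewrite -[i]/(val (Ordinal lti)) nth_thetas scalerA.
  move=> /(in_seq_smul_thetas _ (ltnW lti)) h.
  apply/(in_seq_smul_thetas _ (ltnW lti)).
  exact: (theta_seq_regular Z0 ZD ZM Z_nf Z_nfcoef h).
(* Otherwise 1 would lie in the ideal of the theta_i plus the annihilator, all of whose elements
   vanish at the origin. *)
exists v0; rewrite -[v0]scale1r -[s](take_size) size_thetas.
move=> /(in_seq_smul_thetas _ (leqnn n))[g /Z_at0 /eqP].
rewrite mevalB meval1 rmorph_sum /= big1 ?subr0 ?oner_eq0 // => l _.
by rewrite mevalM theta_at0 mul0r.
Qed.
End CyclicDepth.

(** * The quotients S/H *)

Section FormIdeal.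
Variables (k : fieldType) (n a b : nat) (UU : {set {set 'I_n}}).
Hypotheses (a_gt0 : (0 < a)%N) (UUP : form_family a b UU).
Notation N := (n + n + 1)%N.
Notation S := {mpoly k[N]}.
Notation nf := (normal_form a_gt0 UUP).
Notation mon_state := (@mon_state n a b).

Definition lead_mon (U : {set 'I_n}) : 'X_{1..N} :=
  mkmon [multinom (i \in U) * (a - #|U| * b) | i < n]%N 0 #|U|.

Definition tail_mon (U : {set 'I_n}) : 'X_{1..N} :=
  mkmon [multinom (i \notin U) * (#|U| * b) + (i \in U) * (#|U| * b - a) | i < n]%N
    [multinom (i \in U) : nat | i < n] 0.

(* Uniform expression of the L_i, for U = {i}, and of the Sylvester forms: at most
   one of the truncated subtractions is nonzero. *)
Definition form (U : {set 'I_n}) : S :=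
  (\prod_(i in U) xS k i) ^+ (a - #|U| * b) * wS k n ^+ #|U| -
  (\prod_(i | i \notin U) xS k i) ^+ (#|U| * b) *
  (\prod_(i in U) xS k i) ^+ (#|U| * b - a) * \prod_(i in U) yS k i.

Lemma mkmonE al be j : 'X_[mkmon al be j] =
  \prod_i xS k i ^+ al i * \prod_i yS k i ^+ be i * wS k n ^+ j :> S.
Proof.
rewrite mpolyXE_id prod_N mkmon_w; congr (_ * _ * _).
  by apply: eq_bigr => i _; rewrite mkmon_x.
by apply: eq_bigr => i _; rewrite mkmon_y.
Qed.

Lemma prod_expr_mem (F : 'I_n -> S) (P : pred 'I_n) (e : nat) :
  \prod_i F i ^+ (P i * e) = (\prod_(i | P i) F i) ^+ e.
Proof.
rewrite -prodrXl [RHS]big_mkcond; apply: eq_bigr => i _.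
by case: (P i); rewrite ?mul1n ?mul0n ?expr0.
Qed.

Lemma formE U : form U = 'X_[lead_mon U] - 'X_[tail_mon U].
Proof.
rewrite /form !mkmonE; congr (_ - _).
  rewrite [X in _ * X * _]big1 ?mulr1 => [|i _]; last by rewrite mnm0E expr0.
  by under [in RHS]eq_bigr do rewrite mnmE; rewrite prod_expr_mem.
rewrite expr0 mulr1; congr (_ * _); last first.
  under [in RHS]eq_bigr do rewrite mnmE -[(_ \in _) : nat]muln1.
  by rewrite prod_expr_mem expr1.
under [in RHS]eq_bigr do rewrite mnmE exprD.
by rewrite big_split /= !prod_expr_mem.
Qed.

Lemma head_tail_state U : mon_state (tail_mon U) = ((mon_state (lead_mon U)).1, 0%N).
Proof.
rewrite /tail_mon /lead_mon !mon_state_mkmon /=; congr (_, _, _).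
  by apply/mnmP => i; rewrite !mnmE; case: (i \in U); lia.
rewrite mdeg0 addn0 add0n mdegE -sum1_card [RHS]big_mkcond.
by apply: eq_bigr => i _; rewrite mnmE; case: (i \in U).
Qed.

Lemma nf_head_tail U : U \in UU -> nf (lead_mon U) = nf (tail_mon U).
Proof.
move=> UUU; rewrite /normal_form /normalize head_tail_state; congr (_, _).
rewrite /lead_mon mon_state_mkmon /=; symmetry; apply: reach_nu.
apply: (@reach_step _ _ _ _ _ _ _ #|U|); last by rewrite subnn; apply: reach_refl.
exists U, 0%MM; split=> //; split=> // i.
by rewrite !mnmE !muln0 addn0 [(b * _)%N]mulnC.
Qed.

Definition xay (i l : 'I_n) : 'X_{1..N} := (U_(ix i) *+ a + U_(iy l))%MM.

Lemma formKE i l : formK k a i l = 'X_[xay i l] - 'X_[xay l i] :> S.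
Proof. by rewrite /formK /xay !mpolyXD -!mpolyXn. Qed.

Lemma xay_state i l : mon_state (xay i l) = mon_state (xay l i).
Proof.
rewrite /xay !mon_stateD !mon_state_xa !mon_state_y /=; congr (_, _, _).
by rewrite addmC.
Qed.

Section Membership.
Variable I : S -> Prop.
Hypotheses (I0 : I 0) (ID : forall f g, I f -> I g -> I (f + g))
  (IM : forall f g, I g -> I (f * g)) (IK : forall i l, I ('X_[xay i l] - 'X_[xay l i]))
  (IF : forall U, U \in UU -> I (form U)).

Lemma I_sym m m' : I ('X_[m] - 'X_[m']) -> I ('X_[m'] - 'X_[m]).
Proof. by move=> h; rewrite -opprB -mulN1r; apply: IM. Qed.

Lemma I_trans m m' m'' :
  I ('X_[m] - 'X_[m']) -> I ('X_[m'] - 'X_[m'']) -> I ('X_[m] - 'X_[m'']).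
Proof. by move=> h h'; have := ID h h'; rewrite addrA subrK. Qed.

Lemma I_mulX m m' u : I ('X_[m] - 'X_[m']) -> I ('X_[m + u] - 'X_[m' + u]).
Proof. by move=> h; rewrite !mpolyXD -mulrBl mulrC; apply: IM. Qed.

(** If the y-exponents differ, some y_i is in excess in m and some y_l is lacking. Equality of the
    images forces x_l^a to divide m, so K_(i,l) replaces x_l^a y_i by x_i^a y_l, which decreases the
    total excess. *)
Lemma mon_state_congr m m' : mon_state m = mon_state m' -> I ('X_[m] - 'X_[m']).
Proof.
have [d] := ubnP (\sum_i (m (iy i) - m' (iy i))); elim: d m => [|d IH] m; first by rewrite ltn0.
move=> dm e.
have ew : m (iw n) = m' (iw n) by apply: (congr1 snd e).
have ed : \sum_i m (iy i) = \sum_i m' (iy i).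
  by move: (congr1 (fun st => st.1.2) e) => /=; rewrite ew => /addIn.
have ex i : (m (ix i) + a * m (iy i) = m' (ix i) + a * m' (iy i))%N.
  have /(congr1 (fun u : 'X_{1..n} => u i)) := congr1 (fun st => st.1.1) e.
  by rewrite /= !mnmE ew => /addIn.
pose y (u : 'X_{1..N}) := [multinom u (iy i) | i < n].
have [eqy|ney] := eqVneq (y m) (y m').
  have ey i : m (iy i) = m' (iy i).
    by have /(congr1 (fun u : 'X_{1..n} => u i)) := eqy; rewrite !mnmE.
  rewrite (_ : m = m') ?subrr //; apply: mnmP_N => // i.
  by apply: (@addIn (a * m (iy i))); rewrite ex ey.
have dy : mdeg (y m) = mdeg (y m').
  by rewrite !mdegE; under eq_bigr do rewrite mnmE; rewrite ed; apply: eq_bigr => i _; rewrite mnmE.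
have [||i] := @mdeg_lt_exists n (y m) (y m') => //; first by rewrite dy.
rewrite !mnmE => lti.
have [||l] := @mdeg_lt_exists n (y m') (y m); first by rewrite dy.
  by rewrite eq_sym.
rewrite !mnmE => ltl.
have xl : (a <= m (ix l))%N.
  by have := ex l; have : (a * m (iy l) + a <= a * m' (iy l))%N;
    [rewrite -mulnSr leq_mul2l ltl orbT | lia].
have il : i != l by apply/eqP => eil; move: lti ltl; rewrite eil; lia.
have [u em] : exists u, m = (xay l i + u)%MM.
  exists (m - xay l i)%MM; apply: mnmP_N => [j|j|];
    rewrite mnmDE mnmBE /xay !mnmDE !mulmnE !mnm1E !ixyw.
  - by case: eqP => [<-|_]; lia.
  - by case: eqP => [<-|_]; lia.
  - by lia.
apply: (@I_trans _ (xay i l + u)%MM).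
  by rewrite em; apply: I_mulX.
apply: IH; last first.
  by rewrite mon_stateD xay_state -mon_stateD -em.
rewrite ltnS in dm; apply: leq_trans dm.
rewrite (bigD1 i) //= [ltnRHS](bigD1 i) //= -addSn leq_add //.
  rewrite em !mnmDE !mulmnE !mnm1E !ixyw eqxx eq_sym (negbTE il).
  by move: lti; rewrite em mnmDE /xay mnmDE mulmnE !mnm1E !ixyw eqxx; lia.
apply: leq_sum => j ji; rewrite em !mnmDE !mulmnE !mnm1E !ixyw eq_sym [i == j]eq_sym (negbTE ji).
case: eqP => [->|_]; last by lia.
by move: ltl; rewrite em mnmDE /xay mnmDE mulmnE !mnm1E !ixyw (negbTE il); lia.
Qed.

(** Pass to the representative used by the step, modulo the K_(i,l); it is a multiple of the first
    term of F_U. *)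
Lemma step_congr m u : step a b UU (mon_state m).1.1 (mon_state m).1.2 (mon_state m).2 u ->
  exists2 m', mon_state m' = ((mon_state m).1, (mon_state m).2 - u)%N &
    I ('X_[m] - 'X_[m']).
Proof.
move=> [U [be [UUU <- Uj f]]].
pose m2 := mkmon [multinom (mon_state m).1.1 i - a * be i - (mon_state m).2 * b | i < n]%N
  be (mon_state m).2.
have e2 : mon_state m2 = mon_state m by apply/fits_mkmon/fits0/f.
have [v ev] : exists v, m2 = (lead_mon U + v)%MM.
  exists (m2 - lead_mon U)%MM; apply: mnmP_N => [i|i|]; rewrite mnmDE mnmBE.
  - rewrite /m2 /lead_mon !mkmon_x; have [_ /(_ i)] := f.
    rewrite !mnmE; move: (_ * b)%N (a * be i)%N (m (ix i) + _ + _)%N (_ * (a - _))%N.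
    by move=> q p X E; lia.
  - by rewrite /lead_mon mkmon_y mnm0E subn0.
  - by rewrite /m2 /lead_mon !mkmon_w subnKC.
have hw : (mon_state (lead_mon U)).2 = #|U| by rewrite /lead_mon mon_state_mkmon.
exists (tail_mon U + v)%MM.
  rewrite mon_stateD head_tail_state -e2 ev mon_stateD hw.
  by congr (_, _); rewrite /= addKn.
apply: (@I_trans _ m2); first exact: mon_state_congr.
by rewrite ev; apply: I_mulX; rewrite -formE; apply: IF.
Qed.

Lemma reach_congr A D j j' : reach a b UU A D j j' -> forall m, mon_state m = (A, D, j) ->
  exists2 m', mon_state m' = (A, D, j') & I ('X_[m] - 'X_[m']).
Proof.
elim=> [{}j|{}j u {}j' su _ IH] m em; first by exists m; rewrite ?subrr.
have [|m1] := @step_congr m u; first by rewrite em.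
rewrite em => /IH[m' em' I1'] I1; exists m' => //.
exact: I_trans I1 I1'.
Qed.

Lemma nf_congr m m' : nf m = nf m' -> I ('X_[m] - 'X_[m']).
Proof.
move=> e.
have [m1 e1 I1] : exists2 m1, mon_state m1 = nf m & I ('X_[m] - 'X_[m1]).
  have := nu_reach a_gt0 UUP (mon_state m).1.1 (mon_state m).1.2 (mon_state m).2.
  by move=> /reach_congr; apply; case: (mon_state m) => [[]].
have [m2 e2 I2] : exists2 m2, mon_state m2 = nf m' & I ('X_[m'] - 'X_[m2]).
  have := nu_reach a_gt0 UUP (mon_state m').1.1 (mon_state m').1.2 (mon_state m').2.
  by move=> /reach_congr; apply; case: (mon_state m') => [[]].
apply: I_trans I1 _; apply: (@I_trans _ m2); last exact: I_sym.
by apply: mon_state_congr; rewrite e1 e2.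
Qed.
End Membership.

(** By [nfD], the two terms keep a common normal form after multiplication by any monomial of h. *)
Lemma nfcoef_binomial p q (h : S) st : nf p = nf q ->
  nfcoef nf st (h * ('X_[p] - 'X_[q])) = 0.
Proof.
move=> e; rewrite [h]mpolyE mulr_suml nfcoef_sum big1 // => m _.
rewrite -scalerAl nfcoefZ mulrBr -!mpolyXD -scaleN1r nfcoefD nfcoefZ !nfcoefX.
by rewrite !(addmC m) (nfD m e) mulN1r subrr mulr0.
Qed.

Lemma nfcoef_gen_ideal (G : polS k n -> Prop) :
  (forall g h st, G g -> nfcoef nf st (h * g : S) = 0) ->
  forall (f h : polS k n) st, f \in gen_ideal G -> nfcoef nf st (h * f : S) = 0.
Proof.
move=> hG f h st /gen_idealP[r [c [g [Gg ->]]]].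
rewrite mulr_sumr nfcoef_sum big1 // => i _.
by rewrite mulrA; apply: hG.
Qed.

Lemma quot_depth_ge (G : polS k n -> Prop) :
  (forall i l : 'I_n, (i < l)%N -> formK k a i l \in gen_ideal G) ->
  (forall U, U \in UU -> form U \in gen_ideal G) ->
  (forall f h st, G f -> nfcoef nf st (h * f : S) = 0) ->
  (forall f : S, G f -> f.@[fun=> 0] = 0) ->
  depth_ge (quot_mod G) (maxS k n) n.
Proof.
move=> GK GF Gnf G0.
pose v0 : quot_mod G := quot_pi G 1.
have annE (f : polS k n) : f *: v0 = 0 <-> f \in gen_ideal G.
  have z : quot_pi G 0 = 0 by rewrite /quot_pi raddf0.
  by rewrite [f *: v0]quot_scale_pi mulr1 -z; have := quot_pi_eq G f 0; rewrite subr0.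
apply: (@cyclic_depth_ge k n a b UU a_gt0 UUP _ v0).
- move=> v; have [f ->] := quot_pi_surj v; exists f.
  by rewrite [RHS]quot_scale_pi mulr1.
- move=> m m' e; apply/annE.
  apply: (@nf_congr (fun f : polS k n => f \in gen_ideal G)) => //.
  + exact: rpred0.
  + by move=> f g; apply: rpredD.
  + by move=> f g; apply: gen_idealMl.
  + move=> i l; rewrite -formKE; case: (ltngtP i l) => [|li|/val_inj ->].
    * exact: GK.
    * by rewrite -[formK k a i l]opprB rpredN; apply: GK.
    * by rewrite /formK subrr rpred0.
- by move=> f st /annE fG; rewrite -[f]mul1r; apply: nfcoef_gen_ideal fG => g h st'; apply: Gnf.
- move=> f /annE/gen_idealP[r [c [g [Gg ->]]]].
  rewrite rmorph_sum big1 // => i _.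
  by rewrite rmorphM /= (G0 _ (Gg i)) mulr0.
Qed.
End FormIdeal.

Lemma meval0X (k : fieldType) N (m : 'X_{1..N}) :
  ('X_[m] : {mpoly k[N]}).@[fun=> 0] = (m == 0%MM)%:R.
Proof.
rewrite mevalX; have [->|ne] := eqVneq m 0%MM.
  by rewrite big1 // => i _; rewrite mnm0E expr0.
have [i mi] : exists i, m i != 0%N.
  apply/existsP; apply: contraNT ne; rewrite negb_exists => /forallP h.
  by apply/eqP/mnmP => i; rewrite mnm0E; apply/eqP; have := h i; rewrite negbK.
by rewrite (bigD1 i) //= expr0n (negbTE mi) mul0r.
Qed.

(** * The Sylvester forms up to a given tuple *)

Section SylvesterQuotient.
Variables (k : fieldType) (n a b p : nat).
Hypotheses (n_ge1 : (1 <= n)%N) (a_gt2b : (2 * b < a)%N) (pP : is_p n a b p).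

Lemma p_bounds : (0 < p <= n)%N.
Proof.
move: pP; rewrite /is_p; case: ifP => _; first by case.
by move=> ->; rewrite n_ge1 leqnn.
Qed.

Lemma p_lt_a : (p.-1 * b < a)%N.
Proof.
move: pP; rewrite /is_p -subn1; case: (leqP a (n * b)) => [_|lt ->]; first by case=> _ /andP[].
by apply: leq_ltn_trans lt; rewrite leq_mul2r leq_subr orbT.
Qed.

Lemma form_index_uniq u : form_index (n := n) p u -> uniq u.
Proof.
move=> h; rewrite -(map_inj_uniq val_inj); case: h => [[/sorted_uniq-> //]|->].
- exact: ltn_trans.
- exact: ltnn.
- exact: iota_uniq.
Qed.

Lemma form_index_size u : form_index (n := n) p u -> (0 < size u <= p)%N.
Proof.
have /andP[p0 _] := p_bounds; move=> [[_ h]|/(congr1 size)]; first by lia.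
by rewrite size_map size_iota => ->; rewrite p0 leqnn.
Qed.

Lemma card_tuple_set u : form_index (n := n) p u -> #|[set i in u]| = size u.
Proof. by move=> /form_index_uniq/card_uniqP; rewrite cardsE. Qed.

Lemma form_set1 (i : 'I_n) : form k a b [set i] = formL k a b i.
Proof.
have coE : \prod_(l | l \notin [set i]) xS k l = coprod k [:: i].
  by apply: eq_bigl => l; rewrite !inE.
rewrite /form /formL coE cards1 !big_set1 !mul1n.
have -> : (b - a = 0)%N by lia.
by rewrite expr0 mulr1.
Qed.

(** For |U| < p, (p-1)b < a makes the factor x_U^(ub-a) trivial. For |U| = p <= n, either a <= pb
    and x_U^(a-ub) is trivial, or a > nb, p = n and P(U) = 1. *)
Lemma form_sylvester (u : seq 'I_n) : form_index p u ->
  form k a b [set i in u] = sylvester k a b p u.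
Proof.
move=> fi; have uu := form_index_uniq fi; have su := form_index_size fi.
have setE (F : 'I_n -> {mpoly k[n + n + 1]}) : \prod_(i in [set i in u]) F i = \prod_(i <- u) F i.
  by rewrite big_uniq //; apply: eq_bigl => i; rewrite inE.
have coE : \prod_(i | i \notin [set i in u]) xS k i = coprod k u.
  by apply: eq_bigl => i; rewrite inE.
rewrite /form /sylvester card_tuple_set // !setE coE.
have pb := p_lt_a.
case: (ltnP (size u) p) => [ltp|gep].
  have jb : (size u * b <= p.-1 * b)%N by rewrite leq_mul2r; lia.
  have -> : (size u * b - a = 0)%N by lia.
  by rewrite expr0 mulr1.
have sz : size u = p by lia.
rewrite sz; move: pP; rewrite /is_p; case: (leqP a (n * b)) => [le [_ /andP[_ apb]]|lt pn].
  have -> : (a - p * b = 0)%N by lia.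
  by rewrite expr0 mul1r.
rewrite pn (_ : n * b - a = 0)%N; last by lia.
rewrite expr0 mulr1 (_ : coprod k u = 1) ?expr1n ?mul1r //.
rewrite /coprod big_pred0 // => i; apply/negbF.
have /setP/(_ i) : [set i in u] = [set: 'I_n].
  by apply/eqP; rewrite eqEcard subsetT cardsT card_ord card_tuple_set // sz pn leqnn.
by rewrite !inE.
Qed.

Lemma form_index_enum (V : {set 'I_n}) : (2 <= #|V| <= p - 1)%N -> form_index p (enum V).
Proof.
move=> cV; left; rewrite -cardE; split=> //.
rewrite sorted_map; apply: sorted_filter; first by move=> x y z; apply: ltn_trans.
by rewrite -enumT -sorted_map val_enum_ord iota_ltn_sorted.
Qed.

Variable s : seq 'I_n.

Definition H_tuple (u : seq 'I_n) : Prop := form_index p u /\ (u = s \/ form_before u s).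

(** The singletons stand for the L_i. *)
Definition H_sets : {set {set 'I_n}} :=
  [set U : {set 'I_n} | (#|U| == 1) || `[< exists2 u, H_tuple u & U = [set i in u] >]]%N.

Lemma H_setsP U : U \in H_sets ->
  (exists i, U = [set i]) \/ (exists2 u, H_tuple u & U = [set i in u]).
Proof.
by rewrite inE => /orP[/cards1P|/asboolP]; [left | right].
Qed.

Lemma H_sets1 i : [set i] \in H_sets.
Proof. by rewrite inE cards1. Qed.

Lemma H_sets_index u : H_tuple u -> [set i in u] \in H_sets.
Proof. by move=> hu; rewrite inE; apply/orP; right; apply/asboolP; exists u. Qed.

Lemma H_sets_small U : U \in H_sets -> (0 < #|U|)%N /\ (#|U|.-1 * b < a)%N.
Proof.
move=> /H_setsP[[i ->]|[u [fi _] ->]]; first by rewrite cards1; lia.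
rewrite card_tuple_set //; have /andP[-> le] := form_index_size fi; split=> //.
by apply: leq_ltn_trans p_lt_a; rewrite leq_mul2r -!subn1 leq_sub2r ?orbT.
Qed.

(** The forms are ordered by degree first, so all those of smaller degree are already present. *)
Lemma H_sets_sub (U V : {set 'I_n}) : U \in H_sets -> (0 < #|V| < #|U|)%N -> V \in H_sets.
Proof.
move=> /H_setsP[[i ->]|[u [fi us] ->]]; first by rewrite cards1; lia.
rewrite card_tuple_set // => /andP[V0 ltV]; have /andP[_ up] := form_index_size fi.
have [V1|V1] := leqP #|V| 1; first by rewrite inE eqn_leq V1 V0.
have -> : V = [set i in enum V] by apply/setP => i; rewrite inE mem_enum.
apply: H_sets_index; split; first by apply: form_index_enum; lia.
right; left; rewrite -cardE (leq_trans ltV) //.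
by case: us => [->|[/ltnW|[->]]].
Qed.

Lemma H_sets_family : form_family a b H_sets.
Proof. by split; [exact: H_sets_small | exact: H_sets1 | exact: H_sets_sub]. Qed.

Lemma a_gt0 : (0 < a)%N.
Proof. by lia. Qed.

Notation nf := (normal_form a_gt0 H_sets_family).
Notation S := {mpoly k[n + n + 1]}.

Lemma idealL_gens (P : S -> Prop) :
  (forall i l, P (formK k a i l)) -> (forall U, U \in H_sets -> P (form k a b U)) ->
  forall f, (exists i l : 'I_n, (i < l)%N /\ f = formK k a i l) \/
            (exists i, f = formL k a b i) -> P f.
Proof.
move=> PK PF f [[i [l [_ ->]]]|[i ->]]; first exact: PK.
by rewrite -form_set1; apply/PF/H_sets1.
Qed.

Lemma nfcoef_formK i l (h : S) st : nfcoef nf st (h * formK k a i l) = 0.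
Proof. by rewrite formKE; apply: nfcoef_binomial; rewrite /normal_form xay_state. Qed.

Lemma nfcoef_form U (h : S) st : U \in H_sets -> nfcoef nf st (h * form k a b U) = 0.
Proof. by move=> UU; rewrite formE; apply/nfcoef_binomial/nf_head_tail. Qed.

Lemma formK_at0 i l : (formK k a i l : S).@[fun=> 0] = 0.
Proof.
rewrite formKE mevalB !meval0X; have nz (i' l' : 'I_n) : (xay a i' l' == 0%MM) = false.
  apply/eqP => /(congr1 (fun m : 'X_{1..n + n + 1} => m (iy l'))).
  by rewrite /xay mnmDE mulmnE !mnm1E !ixyw eqxx mnm0E.
by rewrite !nz subr0.
Qed.

Lemma form_at0 U : U \in H_sets -> (form k a b U : S).@[fun=> 0] = 0.
Proof.
move=> /H_sets_small[U0 _]; rewrite formE mevalB !meval0X.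
have /negbTE -> : lead_mon a b U != 0%MM.
  apply/eqP => /(congr1 (fun m : 'X_{1..n + n + 1} => m (iw n))).
  by rewrite mkmon_w mnm0E; lia.
have /card_gt0P[i iU] := U0.
have /negbTE -> : tail_mon a b U != 0%MM.
  apply/eqP => /(congr1 (fun m : 'X_{1..n + n + 1} => m (iy i))).
  by rewrite mkmon_y mnmE mnm0E iU.
by rewrite subr0.
Qed.

Lemma sylvester_quot_depth_ge : depth_ge (quot_mod (H_gens k n a b p s)) (maxS k n) n.
Proof.
have LG f : f \in @idealL k n a b -> f \in gen_ideal (H_gens k n a b p s).
  by move=> fL; apply: gen_ideal_gen; left.
apply: (@quot_depth_ge k n a b H_sets a_gt0 H_sets_family).
- by move=> i l il; apply/LG/gen_ideal_gen; left; exists i, l.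
- move=> U /H_setsP[[i ->]|[u [fi us] ->]].
    by rewrite form_set1; apply/LG/gen_ideal_gen; right; exists i.
  rewrite form_sylvester //; apply: gen_ideal_gen; right; exists u.
  by split.
- move=> f h st [fL|[u [fi us ->]]]; last first.
    by rewrite -form_sylvester //; apply/nfcoef_form/H_sets_index.
  apply: nfcoef_gen_ideal fL => g h' st'.
  apply: (@idealL_gens (fun g => nfcoef nf st' (h' * g) = 0)).
    by move=> i l; apply: nfcoef_formK.
  by move=> U; apply: nfcoef_form.
- move=> f [/gen_idealP[r [c [g [Gg ->]]]]|[u [fi us ->]]]; last first.
    by rewrite -form_sylvester //; apply/form_at0/H_sets_index.
  rewrite rmorph_sum big1 // => i _; rewrite rmorphM /=.
  rewrite (_ : (g i : S).@[fun=> 0] = 0) ?mulr0 //.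
  exact: (@idealL_gens (fun f => f.@[fun=> 0] = 0) formK_at0 form_at0 _ (Gg i)).
Qed.

End SylvesterQuotient.

(** * The Rees algebra *)

Section Rees.
Variables (k : fieldType) (n a b : nat).
Hypothesis a_gt0 : (0 < a)%N.
Notation S := {mpoly k[n + n + 1]}.
Notation R := {mpoly k[n]}.
Notation rees := (@rees_map k n a b).

(** All the F_U vanish in R[It]; this family is large enough for the normal form to be determined by
    the image, see [nf_fst]. *)
Definition small_sets : {set {set 'I_n}} :=
  [set U : {set 'I_n} | (0 < #|U|) && (#|U|.-1 * b < a)]%N.

Lemma small_sets_all U : (U \in small_sets) = ((0 < #|U|) && (#|U|.-1 * b < a))%N.
Proof. by rewrite inE. Qed.

Lemma small_sets_small U : U \in small_sets -> (0 < #|U|)%N /\ (#|U|.-1 * b < a)%N.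
Proof. by rewrite inE => /andP. Qed.

Lemma small_sets1 i : [set i] \in small_sets.
Proof. by rewrite inE cards1. Qed.

Lemma small_sets_sub (U V : {set 'I_n}) :
  U \in small_sets -> (0 < #|V| < #|U|)%N -> V \in small_sets.
Proof.
rewrite !inE => /andP[_ Ub] /andP[-> VU]; apply: leq_ltn_trans Ub.
by rewrite leq_mul2r; lia.
Qed.

Lemma small_sets_family : form_family a b small_sets.
Proof.
by split; [exact: small_sets_small | exact: small_sets1 | exact: small_sets_sub].
Qed.

Notation nf := (normal_form a_gt0 small_sets_family).
Notation mon_state := (@mon_state n a b).

Lemma rees_x i : rees 'X_(ix i) = ('X_i : R)%:P.
Proof. by rewrite /rees_map mmapX mmap1U /rees_var (unsplitK (inl _)) (unsplitK (inl _)). Qed.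

Lemma rees_y i : rees 'X_(iy i) = ('X_i ^+ a : R) *: 'X.
Proof. by rewrite /rees_map mmapX mmap1U /rees_var (unsplitK (inl _)) (unsplitK (inr _)). Qed.

Lemma rees_w : rees 'X_(iw n) = ((\prod_(j < n) 'X_j) ^+ b : R) *: 'X.
Proof. by rewrite /rees_map mmapX mmap1U /rees_var (unsplitK (inr _)). Qed.

Lemma rees_C c : rees c%:MP = (c%:MP : R)%:P.
Proof. by rewrite /rees_map mmapC. Qed.

Lemma rees_mon m : rees 'X_[m] =
  ('X_[(mon_state m).1.1] : R) *: 'X^((mon_state m).1.2).
Proof.
rewrite mpolyXE_id rmorph_prod /=; under eq_bigr do rewrite rmorphXn.
rewrite prod_N /= rees_w; under eq_bigr do rewrite rees_x -polyC_exp.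
under [X in _ * X * _]eq_bigr do rewrite rees_y exprZn.
rewrite exprZn -rmorph_prod scaler_prod prodrXr mul_polyC -!scalerAl -scalerAr !scalerA.
rewrite -exprD; congr (_ *: _).
rewrite [RHS]mpolyXE_id; under [RHS]eq_bigr do rewrite mnmE !exprD.
rewrite !big_split /=; congr (_ * _ * _); first by apply: eq_bigr => i _; rewrite exprM.
by rewrite -exprM prodrXl.
Qed.

Lemma rees_eq (f : S) : rees f =
  \sum_(m <- msupp f) (f@_m)%:MP *: (('X_[(mon_state m).1.1] : R) *: 'X^((mon_state m).1.2)).
Proof.
rewrite {1}[f]mpolyE rmorph_sum; apply: eq_bigr => m _.
by rewrite -mul_mpolyC rmorphM /= rees_C rees_mon mul_polyC.
Qed.

Lemma rees_coef (f : S) A D :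
  ((rees f)`_D)@_A = \sum_(m <- msupp f | (mon_state m).1 == (A, D)) f@_m.
Proof.
rewrite rees_eq coef_sum raddf_sum [RHS]big_mkcond; apply: eq_bigr => m _.
case: (mon_state m) => [[A' D'] j] /=.
rewrite !coefZ coefXn mul_mpolyC mcoeffZ xpair_eqE andbC eq_sym.
case: eqP => _; last by rewrite mulr0 mcoeff0 mulr0.
by rewrite mulr1 mcoeffX; case: eqP => _; rewrite ?mulr1 ?mulr0.
Qed.

Lemma rees_nf_congr m m' : nf m = nf m' -> rees ('X_[m] - 'X_[m']) = 0.
Proof.
move=> e; rewrite rmorphB /= !rees_mon.
have -> : (mon_state m).1 = (mon_state m').1 by apply: (congr1 fst e).
by rewrite subrr.
Qed.

Lemma nf_fst m m' : (mon_state m).1 = (mon_state m').1 -> nf m = nf m'.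
Proof.
move=> e; have nm := normal_nf a_gt0 small_sets_family m.
have nm' := normal_nf a_gt0 small_sets_family m'.
have e1 : (nf m).1 = (nf m').1 by exact: e.
rewrite [nf m]surjective_pairing [nf m']surjective_pairing; congr (_, _) => //.
case: nm nm' => r ir [r' ir']; rewrite e1 in r ir.
apply/eqP; rewrite eqn_leq.
by rewrite (irr_unique_le a_gt0 small_sets_all r ir r')
  (irr_unique_le a_gt0 small_sets_all r' ir' r).
Qed.

(** By [nf_fst] the monomials with a given normal form are those with a given image x^A t^D, so this
    coordinate is a coefficient of the image of f. *)
Lemma rees_nfcoef (f : S) st : rees f = 0 -> nfcoef nf st f = 0.
Proof.
move=> f0; have [[m0 e0]|no] := pselect (exists m, nf m = st); last first.
  by rewrite /nfcoef big_pred0 // => m; apply/eqP => e; apply: no; exists m.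
transitivity ((rees f)`_(mon_state m0).1.2)@_((mon_state m0).1.1).
  rewrite rees_coef -surjective_pairing; apply: eq_bigl => m.
  rewrite -e0; apply/eqP/eqP => [e|]; last exact: nf_fst.
  exact: (congr1 fst e).
by rewrite f0 coef0 mcoeff0.
Qed.

(** Only the monomial 1 has image 1, so f and its image have the same constant term. *)
Lemma rees_at0 (f : S) : rees f = 0 -> f.@[fun=> 0] = 0.
Proof.
move=> f0; transitivity (((rees f)`_0)@_0); last by rewrite f0 coef0 mcoeff0.
rewrite rees_coef {1}[f]mpolyE rmorph_sum [RHS]big_mkcond; apply: eq_bigr => m _ /=.
rewrite mevalZ meval0X (_ : (m == 0%MM) = ((mon_state m).1 == (0%MM, 0%N))).
  by case: eqP => _; rewrite ?mulr1 ?mulr0.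
apply/eqP/eqP => [->|e].
  rewrite /mon_state mnm0E; congr (_, _); last by rewrite big1 // => i _; rewrite mnm0E.
  by apply/mnmP => i; rewrite !mnmE; lia.
have /(congr1 (fun u : 'X_{1..n} => u _)) eA := congr1 fst e.
have /eqP := congr1 snd e; rewrite /= addn_eq0 sum_nat_eq0 => /andP[/forallP y0 /eqP w0].
apply: mnmP_N => [i|i|]; rewrite mnm0E //; last by apply/eqP; have := y0 i.
by have := eA i; rewrite /= mnmE mnm0E; lia.
Qed.

Definition in_rees_image (g : {poly R}) : Prop := exists f, rees f = g.

Lemma imageD f g : in_rees_image f -> in_rees_image g -> in_rees_image (f + g).
Proof. by move=> [u <-] [v <-]; exists (u + v); rewrite rmorphD. Qed.

Lemma imageM f g : in_rees_image f -> in_rees_image g -> in_rees_image (f * g).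
Proof. by move=> [u <-] [v <-]; exists (u * v); rewrite rmorphM. Qed.

Lemma image_sum (I : Type) (r : seq I) (P : pred I) (F : I -> {poly R}) :
  (forall i, P i -> in_rees_image (F i)) -> in_rees_image (\sum_(i <- r | P i) F i).
Proof.
by move=> h; apply: big_ind => //; [exists 0; rewrite rmorph0 | exact: imageD].
Qed.

Lemma image_prod (I : Type) (r : seq I) (P : pred I) (F : I -> {poly R}) :
  (forall i, P i -> in_rees_image (F i)) -> in_rees_image (\prod_(i <- r | P i) F i).
Proof.
by move=> h; apply: big_ind => //; [exists 1; rewrite rmorph1 | exact: imageM].
Qed.

Lemma image_polyC (c : R) : in_rees_image c%:P.
Proof.
rewrite [c]mpolyE rmorph_sum; apply: image_sum => m _; rewrite -mul_mpolyC rmorphM /=.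
apply: imageM; first by exists (c@_m)%:MP; rewrite rees_C.
rewrite mpolyXE_id rmorph_prod /=; apply: image_prod => i _.
by exists ('X_(ix i) ^+ m i); rewrite rmorphXn /= rees_x polyC_exp.
Qed.

(** The part of degree j is spanned over R by products of j elements of I t, and I t is spanned over
    R by the images of the y_i and of w. *)
Lemma rees_onto (g : {poly R}) : g \in rees_pred (@idealI k n a b) -> in_rees_image g.
Proof.
move=> /rees_predP gI; rewrite -[g]coefK poly_def; apply: image_sum => j _.
have /gen_idealP[r [c [h [hI ->]]]] := gI j.
rewrite scaler_suml; apply: image_sum => t _.
have [f [fI ->]] := hI t; rewrite -scalerA -mul_polyC; apply: imageM; first exact: image_polyC.
rewrite (_ : _ *: _ = \prod_(l < j) (f l *: 'X)); last first.
  by rewrite scaler_prod prodr_const card_ord.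
apply: image_prod => l _; have /gen_idealP[r' [c' [h' [hI' ->]]]] := fI l.
rewrite scaler_suml; apply: image_sum => u _; rewrite -scalerA -mul_polyC.
apply: imageM; first exact: image_polyC.
case: (hI' u) => [[i ->]|->]; first by exists 'X_(iy i); rewrite rees_y.
by exists 'X_(iw n); rewrite rees_w.
Qed.

Lemma rees_depth_ge : rees_almost_CM k n a b.
Proof.
have annE (f : polS k n) : f *: (1 : rees_mod k n a b) = 0 <-> rees f = 0.
  split=> [/(congr1 val)|f0]; first by rewrite /= mulr1.
  by apply: val_inj; rewrite /= mulr1.
apply: (@cyclic_depth_ge k n a b small_sets a_gt0 small_sets_family _ (1 : rees_mod k n a b)).
- move=> v; have [f ef] := rees_onto (valP v); exists f.
  by apply: val_inj; rewrite /= mulr1.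
- by move=> m m' e; apply/annE/rees_nf_congr.
- by move=> f st /annE/rees_nfcoef.
- by move=> f /annE/rees_at0.
Qed.
End Rees.

Theorem theorem2p5 (k : fieldType) (n a b : nat)
    (n_ge1 : (1 <= n)%N) (b_gt0 : (0 < b)%N) (a_gt2b : (2 * b < a)%N) :
  (forall (p : nat) (s : seq 'I_n),
     is_p n a b p -> form_index p s ->
     depth_ge (quot_mod (H_gens k n a b p s)) (maxS k n) n)
  /\ rees_almost_CM k n a b.
Proof.
split=> [p s pP _|]; first exact: sylvester_quot_depth_ge.
by apply: rees_depth_ge; apply: leq_ltn_trans a_gt2b.
Qed.
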